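(* Let $\zeta\in\mathbb R$ be a constant. For $\beta>0$ let $\Psi_\beta$ be the solution of $$-\Delta\Psi_\beta+\beta\Phi(\Psi_\beta)=0\ \text{ in }Y_F,\qquad \Psi_\beta=\zeta\ \text{ on }S,\qquad \Psi_\beta\ \text{1-periodic},$$ and let $\Psi_1$ be the solution of $$-\Delta\Psi_1=-\Phi(\zeta)\ \text{ in }Y_F,\qquad \Psi_1=0\ \text{ on }S,\qquad \Psi_1\ \text{1-periodic}.$$ Then there exists a positive constant $C$, independent of $\beta$, such that for all sufficiently small $\beta>0$ $$\|\Psi_\beta-\zeta-\beta\Psi_1\|_{H^1(Y_F)}\le C\beta^2 .$$
   Context: Geometry: $Y=(0,1)^d$ is the periodic unit cell, identified with the unit torus $\mathbb T^d$; $Y=Y_S\cup Y_F$ is a smooth partition, with $Y_F$ a 1-periodic smooth connected open subset, and $S=\partial Y_S\setminus\partial Y$ is the (nonempty) interface. Data: integers $z_1<z_2<\dots<z_N$ with $z_1<0<z_N$; constants $n_j^0(\infty)>0$ ($1\le j\le N$) satisfying $\sum_{j=1}^N z_jn_j^0(\infty)=0$. Set $\Phi(s)=-\sum_{j=1}^N z_jn_j^0(\infty)e^{-z_js}$. Solutions are understood in the weak sense, in the space of 1-periodic $H^1(Y_F)$ functions. *)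

(* Defs.v *)
From HB Require Import structures.
From mathcomp Require Import all_boot all_order all_algebra generic_quotient.
From mathcomp Require Import all_classical all_reals all_analysis.

Set Implicit Arguments.
Unset Strict Implicit.
Unset Printing Implicit Defensive.

Import Order.TTheory GRing.Theory Num.Theory.
Import numFieldNormedType.Exports.

Local Open Scope classical_set_scope.
Local Open Scope ring_scope.

(* 'rV[R]_n carries the sigma-algebra generated by its coordinates, i.e. the
   product (= Borel) sigma-algebra, exactly as the library does for
   n.-tuple T. *)
Definition measure_rV_display : measure_display. Proof. exact. Qed.

Section measurable_rV.
Context {R : realType} (n : nat).

Definition coord_rV (i : 'I_n) (x : 'rV[R]_n) : measurableTypeR R := x ord0 i.

Let rV_set0 : g_sigma_preimage coord_rV set0.
Proof. exact: sigma_algebra0. Qed.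

Let rV_setC A : g_sigma_preimage coord_rV A -> g_sigma_preimage coord_rV (~` A).
Proof. exact: sigma_algebraC. Qed.

Let rV_bigcup (F : _^nat) : (forall i, g_sigma_preimage coord_rV (F i)) ->
  g_sigma_preimage coord_rV (\bigcup_i (F i)).
Proof. exact: sigma_algebra_bigcup. Qed.

HB.instance Definition _ := @isMeasurable.Build measure_rV_display
  'rV[R]_n (g_sigma_preimage coord_rV) rV_set0 rV_setC rV_bigcup.

End measurable_rV.

Lemma measurable_coord_rV (R : realType) n (i : 'I_n) :
  measurable_fun [set: 'rV[R]_n] (coord_rV i).
Proof.
move=> _ Y mY; rewrite setTI; apply: sub_sigma_algebra => /=.
rewrite -bigcup_seq/=; exists i => /=; first by rewrite mem_index_enum.
by exists Y => //; rewrite setTI.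
Qed.

Lemma measurable_fun_rVP d (T : measurableType d) (R : realType) n
    (f : T -> 'rV[R]_n) :
  measurable_fun [set: T] f <->
  forall i, measurable_fun [set: T] (coord_rV i \o f).
Proof.
split=> [mf i|mf]; first by apply: measurableT_comp => //;
  exact: measurable_coord_rV.
have H : g_sigma_preimage (fun i => coord_rV i \o f) `<=` measurable.
  apply: smallest_sub; first exact: sigma_algebra_measurable.
  case: n => [|n] in f mf *; first by rewrite big_ord0.
  rewrite -bigcup_mkord_ord; apply: bigcup_sub => i Ii.
  by move=> A [B mB <-]; exact: mf.
move: H; rewrite g_sigma_preimage_comp => H _ A mA.
by apply: H; exists A.
Qed.

Section lebesgue_rV.
Context {R : realType}.

Definition cons_rV n (p : measurableTypeR R * 'rV[R]_n) : 'rV[R]_n.+1 :=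
  row_mx (p.1 : R)%:M p.2.

Lemma cons_rV_head n p : coord_rV ord0 (@cons_rV n p) = p.1.
Proof.
have -> : ord0 = lshift n (ord0 : 'I_1) by exact/val_inj.
by apply: etrans (row_mxEl _ _ _ _) _; rewrite mxE eqxx.
Qed.

Lemma cons_rV_tail n p (j : 'I_n) :
  coord_rV (lift ord0 j) (@cons_rV n p) = coord_rV j p.2.
Proof.
have -> : lift ord0 j = rshift 1 j by exact/val_inj.
exact: row_mxEr.
Qed.

Lemma measurable_cons_rV n : measurable_fun [set: _] (@cons_rV n).
Proof.
apply/measurable_fun_rVP => i; case: (unliftP ord0 i) => [j ->|->].
  have -> : coord_rV (lift ord0 j) \o @cons_rV n = coord_rV j \o snd.
    by apply/funext => p; exact: cons_rV_tail.
  by apply: measurableT_comp => //; exact: measurable_coord_rV.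
have -> : coord_rV ord0 \o @cons_rV n = fst.
  by apply/funext => p; exact: cons_rV_head.
exact: measurable_fst.
Qed.

Definition uncons_rV n (x : 'rV[R]_n.+1) : measurableTypeR R * 'rV[R]_n :=
  (coord_rV ord0 x, \row_j x ord0 (lift ord0 j)).

Lemma cons_rVK n : cancel (@cons_rV n) (@uncons_rV n).
Proof.
move=> [a v]; congr pair; first exact: (cons_rV_head (a, v)).
by apply/rowP => j; rewrite mxE; exact: (cons_rV_tail (a, v) j).
Qed.

Lemma uncons_rVK n : cancel (@uncons_rV n) (@cons_rV n).
Proof.
move=> x; apply/rowP => i; case: (unliftP ord0 i) => [j ->|->].
  by apply: etrans (cons_rV_tail _ _) _; rewrite /coord_rV mxE.
exact: cons_rV_head.
Qed.

Lemma measurable_uncons_rV n : measurable_fun [set: _] (@uncons_rV n).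
Proof.
apply/measurable_fun_pairP; split; first exact: measurable_coord_rV.
apply/measurable_fun_rVP => j.
rewrite [X in measurable_fun _ X](_ : _ = coord_rV (lift ord0 j)).
  exact: measurable_coord_rV.
by apply/funext => x; rewrite /coord_rV /= mxE.
Qed.

Section step.
Variables (n : nat) (m : {sigma_finite_measure set 'rV[R]_n -> \bar R}).

Definition lebesgue_rVS : set 'rV[R]_n.+1 -> \bar R :=
  pushforward ((@lebesgue_measure R) \x m)%E (@cons_rV n).

Let m0 : lebesgue_rVS set0 = 0%E.
Proof. by rewrite /lebesgue_rVS /pushforward preimage_set0 measure0. Qed.

Let mge0 A : (0 <= lebesgue_rVS A)%E.
Proof. by rewrite /lebesgue_rVS /pushforward; apply: measure_ge0. Qed.

Let msigma : semi_sigma_additive lebesgue_rVS.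
Proof.
move=> F mF tF mUF; rewrite /lebesgue_rVS /pushforward preimage_bigcup.
have mp A : measurable A -> measurable (@cons_rV n @^-1` A).
  by move=> mA; rewrite -[X in measurable X]setTI; exact: measurable_cons_rV.
apply: measure_semi_sigma_additive.
- by move=> k; apply: mp; exact: mF.
- apply/trivIsetP => /= i j _ _ ij; rewrite -preimage_setI.
  by move/trivIsetP : tF => /(_ _ _ _ _ ij) ->//; rewrite preimage_set0.
- by rewrite -preimage_bigcup; exact: mp.
Qed.

HB.instance Definition _ := isMeasure.Build _ _ _ lebesgue_rVS m0 mge0 msigma.

Let prod_sfin (m1 : {sigma_finite_measure set (measurableTypeR R) -> \bar R}) :
  sigma_finite setT (m1 \x m)%E.
Proof.
have /sigma_finiteP[F [TF ndF Foo]] := sigma_finiteT m1.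
have /sigma_finiteP[G [TG ndG Goo]] := sigma_finiteT m.
exists (fun k => F k `*` G k).
  rewrite -setXTT TF TG predeqE => -[x y]; split.
    move=> [/= [i _ Fix] [j _ Gjy]]; exists (maxn i j) => //; split.
    - by move: x Fix; exact/subsetPset/ndF/leq_maxl.
    - by move: y Gjy; exact/subsetPset/ndG/leq_maxr.
  by move=> [i _ []/= ? ?]; split; exists i.
move=> k; have [? ?] := Foo k; have [? ?] := Goo k.
split; first exact: measurableX.
by rewrite product_measure1E// lte_mul_pinfty// ge0_fin_numE.
Qed.

Let sfin : sigma_finite setT lebesgue_rVS.
Proof.
have [F FT mF] := prod_sfin (@lebesgue_measure R).
exists (fun k => @uncons_rV n @^-1` F k) => [|k].
  by rewrite -preimage_bigcup -FT preimage_setT.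
have [mFk Fk] := mF k; split.
  by rewrite -[X in measurable X]setTI; exact: measurable_uncons_rV.
rewrite /lebesgue_rVS /pushforward -comp_preimage.
have -> : @uncons_rV n \o @cons_rV n = id by apply/funext; exact: cons_rVK.
by rewrite preimage_id.
Qed.

HB.instance Definition _ :=
  Measure_isSigmaFinite.Build _ _ _ lebesgue_rVS sfin.

End step.

Fixpoint lebesgue_rV n : {sigma_finite_measure set 'rV[R]_n -> \bar R} :=
  match n with
  | 0 => [the {sigma_finite_measure set 'rV[R]_0 -> \bar R} of \d_(0 : 'rV[R]_0)]
  | n'.+1 => [the {sigma_finite_measure set 'rV[R]_n'.+1 -> \bar R}
                of lebesgue_rVS (lebesgue_rV n')]
  end.

End lebesgue_rV.
Local Notation mu := (lebesgue_rV _).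

Section torus.
Context (R : realType) (d : nat).

Local Notation e i := (delta_mx 0 i : 'rV[R]_d).

Definition unit_cell : set 'rV[R]_d := [set x | forall i, 0 < x 0 i < 1].

(* Objects on the torus T^d = R^d / Z^d are represented by their 1-periodic
   lifts to R^d; with T := Prop this applies to subsets of R^d. *)
Definition periodic T (f : 'rV[R]_d -> T) := forall i x, f (x + e i) = f x.

Definition lattice_rel (x y : 'rV[R]_d) : bool :=
  [forall i, (x - y) 0 i \is a Num.int].

Lemma lattice_rel_refl : reflexive lattice_rel.
Proof. by move=> x; apply/forallP => i; rewrite subrr mxE rpred0. Qed.

Lemma lattice_rel_sym : symmetric lattice_rel.
Proof.
by move=> x y; apply/eq_forallb => i; rewrite -opprB mxE rpredN.
Qed.

Lemma lattice_rel_trans : transitive lattice_rel.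
Proof.
move=> y x z /forallP xy /forallP yz; apply/forallP => i.
by rewrite -(subrK y x) -addrA mxE rpredD.
Qed.

Canonical lattice_equiv :=
  EquivRel lattice_rel lattice_rel_refl lattice_rel_sym lattice_rel_trans.

Definition torus := quotient_topology {eq_quot lattice_equiv}%qT.

End torus.

Section domains.
Context (R : realType) (d : nat).
Implicit Types (E : set 'rV[R]_d) (f g : 'rV[R]_d -> R).

Definition partial (i : 'I_d) f : 'rV[R]_d -> R :=
  fun x => 'D_(delta_mx 0 i) f x.

Fixpoint Ck (k : nat) f : Prop :=
  continuous f /\
  if k is k'.+1 then
    forall i, (forall x, derivable f x (delta_mx 0 i)) /\ Ck k' (partial i f)
  else True.

Definition smooth f := forall k, Ck k f.

(* The topological boundary; for E the (lifted) fluid part this is the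
   interface between E and its complement, the solid part. *)
Definition interface E : set 'rV[R]_d := closure E `&` closure (~` E).

(* E lies locally on one side of a smooth hypersurface. *)
Definition smooth_boundary E := forall x, interface E x ->
  exists g, [/\ smooth g, g x = 0, exists i, partial i g x != 0 &
    \forall y \near x, E y <-> g y < 0].

Definition fluid_domain E :=
  [/\ open E, periodic E, connected (\pi_(torus R d)%qT @` E),
      smooth_boundary E & interface E !=set0].

End domains.

Section sobolev.
Context (R : realType) (d : nat) (E : set 'rV[R]_d).
Implicit Types (u v phi : 'rV[R]_d -> R) (Du Dv : 'rV[R]_d -> 'rV[R]_d).

Definition fluid_cell : set 'rV[R]_d := @unit_cell R d `&` E.
Local Notation Y_F := fluid_cell.

(* Periodic and C^1, with compact support in the image of E in the torus (the
   torus being compact, it is enough that the closed support lies in E). *)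
Definition test_function phi :=
  [/\ Ck 1 phi, periodic phi & closure [set x | phi x != 0] `<=` E].

Definition H1_energy u Du : \bar R :=
  (\int[mu]_(x in Y_F) (u x ^+ 2 + \sum_(i < d) Du x 0 i ^+ 2)%:E)%E.

(* u is a 1-periodic H^1 function on E and Du is its weak gradient, as
   distributions on the torus: the test functions need not vanish on the faces
   of the unit cell. *)
Definition H1_weak_gradient u Du :=
  [/\ periodic u,
      measurable_fun Y_F u,
      forall i, measurable_fun Y_F (fun x => Du x 0 i),
      (H1_energy u Du < +oo)%E &
      forall phi i, test_function phi ->
        (\int[mu]_(x in Y_F) (u x * partial i phi x)%:E =
         - \int[mu]_(x in Y_F) (Du x 0 i * phi x)%:E)%E].

(* +oo when u is not H^1; otherwise weak gradients agree a.e. and the infimum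
   is the value at any of them. *)
Definition H1_norm u : \bar R :=
  ereal_inf [set (H1_energy u Du `^ 2^-1)%E | Du in H1_weak_gradient u].

(* u vanishes on the interface: (u, Du) is an H^1-limit of test functions. *)
Definition H10_weak_gradient u Du :=
  H1_weak_gradient u Du /\
  exists phi : nat -> 'rV[R]_d -> R,
    (forall n, test_function (phi n)) /\
    H1_energy (fun x => u x - phi n x)
              (fun x => \row_i (Du x 0 i - partial i (phi n) x)) @[n --> \oo]
      --> 0%E.

(* Periodic weak solutions of
     - Delta Psi + f Psi = 0 in E,   Psi = g on the interface.
   As f may grow exponentially, f \o Psi is required to be integrable and the
   equation is tested against bounded functions of H^1_0. *)
Definition weak_solution (f : R -> R) (g : R) (Psi : 'rV[R]_d -> R) :=
  exists DPsi : 'rV[R]_d -> 'rV[R]_d,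
  [/\ H1_weak_gradient Psi DPsi,
      H10_weak_gradient (fun x => Psi x - g) DPsi,
      mu.-integrable Y_F (fun x => (f (Psi x))%:E) &
      forall v Dv, H10_weak_gradient v Dv ->
        (exists M, forall x, `|v x| <= M) ->
        (\int[mu]_(x in Y_F)
           (\sum_(i < d) DPsi x 0 i * Dv x 0 i + f (Psi x) * v x)%:E = 0)%E].

End sobolev.

Definition Phi (R : realType) (N : nat) (z : 'I_N -> int) (n0 : 'I_N -> R)
    (s : R) : R :=
  - \sum_(j < N) (z j)%:~R * n0 j * expR (- (z j)%:~R * s).

(* Main.v *)
(* Put u = Psi_beta - zeta and w = u - beta Psi_1.  Testing the equation with a
   smooth increasing function of u that vanishes on [-|zeta|, |zeta|] gives
   |u| <= |zeta| almost everywhere, since Phi is increasing and Phi(0) = 0.  On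
   that range Phi is Lipschitz, with a constant L say, and the difference
   G = Phi(zeta + u) - Phi(zeta) has the sign of u.  The equation for w is
   - Delta w + beta G = 0.  If G w < 0 then |u| <= beta |Psi_1|, so that
   - G w <= L beta |Psi_1| |w| in all cases, and testing with w gives
     int |grad w|^2 <= L beta^2 int |Psi_1| |w|,
   whence the estimate by Young's inequality and the Poincare inequality.
   The Poincare inequality holds because the interface forces the complement of
   the fluid to contain a box, on which every test function vanishes.  Weak
   gradients of nonlinear functions of u are never formed: the nonlinear test is
   made with test functions approximating u. *)

Require Import Defs.
From mathcomp Require Import all_boot all_order all_algebra ring lra.
From mathcomp Require Import all_classical all_reals all_analysis.
From mathcomp Require Import measurable_realfun.

Set Implicit Arguments.
Unset Strict Implicit.
Unset Printing Implicit Defensive.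

Import Order.TTheory GRing.Theory Num.Theory.
Import numFieldNormedType.Exports.

Local Open Scope classical_set_scope.
Local Open Scope ring_scope.

(** * Tonelli on the unit cell *)

(** The weak equation admits only bounded members of H^1_0, and neither [w] nor [Psi1] is shown to
    be bounded; this shapes the proof. The maximum principle removes the obstacle: once |u| <=
    |zeta|, the difference of the nonlinear terms is at most beta L |u|, hence square integrable,
    and an equation with square-integrable coefficients extends by density from test functions to
    all of H^1_0, [w] included. In the maximum principle itself Phi(Psi) is merely integrable, so it
    is truncated at a height k, and the boundedness of the nonlinear test function pays for the
    tail. The sign of G replaces a Taylor expansion of Phi at zeta, so that of [Psi1] only the
    integral of its square enters. Integration by parts and the Poincare inequality are proved on
    the whole cell, a product of intervals, and carried over to Y_F because test functions and their
    derivatives vanish off E. *)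

Section tonelli_setX.
Local Open Scope ereal_scope.
Context d1 d2 (T1 : measurableType d1) (T2 : measurableType d2) (R : realType).
Variables (m1 : {sigma_finite_measure set T1 -> \bar R}).
Variables (m2 : {sigma_finite_measure set T2 -> \bar R}).
Variables (A : set T1) (B : set T2) (f : T1 * T2 -> \bar R).
Hypotheses (mA : measurable A) (mB : measurable B).
Hypotheses (mf : measurable_fun setT f) (f0 : forall z, 0 <= f z).

Let g := f \_ (A `*` B).

Let mg : measurable_fun setT g.
Proof.
have mAB : measurable (A `*` B) by exact: measurableX.
by apply/(measurable_restrictT f mAB); exact: measurable_funTS.
Qed.

Let g0 z : 0 <= g z.
Proof. exact: erestrict_ge0. Qed.

Let gF x : \int[m2]_y g (x, y) = ((fun x => \int[m2]_(y in B) f (x, y)) \_ A) x.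
Proof.
rewrite patchE; case: ifPn => xA.
  rewrite [RHS]integral_mkcond; apply: eq_integral => y _.
  by rewrite /g !patchE in_setX xA.
by rewrite integral0_eq// => y _; rewrite /g patchE in_setX (negbTE xA).
Qed.

Let gG y : \int[m1]_x g (x, y) = ((fun y => \int[m1]_(x in A) f (x, y)) \_ B) y.
Proof.
rewrite patchE; case: ifPn => yB.
  rewrite [RHS]integral_mkcond; apply: eq_integral => x _.
  by rewrite /g !patchE in_setX yB andbT.
by rewrite integral0_eq// => x _; rewrite /g patchE in_setX (negbTE yB) andbF.
Qed.

Lemma tonelli_setX1 : \int[m1 \x m2]_(z in A `*` B) f z =
  \int[m1]_(x in A) \int[m2]_(y in B) f (x, y).
Proof.
rewrite integral_mkcond (fubini_tonelli1 g mg g0) [RHS]integral_mkcond.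
by apply: eq_integral => x _; exact: gF.
Qed.

Lemma tonelli_setX2 : \int[m1 \x m2]_(z in A `*` B) f z =
  \int[m2]_(y in B) \int[m1]_(x in A) f (x, y).
Proof.
rewrite integral_mkcond (fubini_tonelli2 g mg g0) [RHS]integral_mkcond.
by apply: eq_integral => x _; exact: gG.
Qed.

End tonelli_setX.

Section measurable_tonelli.
Local Open Scope ereal_scope.
Context d1 d2 (T1 : measurableType d1) (T2 : measurableType d2) (R : realType).

Lemma measurable_integral_snd (m2 : {sigma_finite_measure set T2 -> \bar R})
    (B : set T2) (f : T1 * T2 -> \bar R) :
  measurable B -> measurable_fun setT f -> (forall z, 0 <= f z) ->
  measurable_fun setT (fun x => \int[m2]_(y in B) f (x, y)).
Proof.
move=> mB mf f0.
have mg : measurable_fun setT (f \_ ([set: T1] `*` B)).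
  have mTB : measurable ([set: T1] `*` B) by exact: measurableX.
  by apply/(measurable_restrictT f mTB); exact: measurable_funTS.
have := @measurable_fun_fubini_tonelli_F _ _ _ _ _ m2 _ mg (fun z =>
    erestrict_ge0 (fun z _ => f0 z) z).
apply: eq_measurable_fun => x _; rewrite /fubini_F [RHS]integral_mkcond.
by apply: eq_integral => y _; rewrite !patchE in_setX in_setT.
Qed.

Lemma measurable_integral_fst (m1 : {sigma_finite_measure set T1 -> \bar R})
    (A : set T1) (f : T1 * T2 -> \bar R) :
  measurable A -> measurable_fun setT f -> (forall z, 0 <= f z) ->
  measurable_fun setT (fun y => \int[m1]_(x in A) f (x, y)).
Proof.
move=> mA mf f0.
have mg : measurable_fun setT (f \_ (A `*` [set: T2])).
  have mTA : measurable (A `*` [set: T2]) by exact: measurableX.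
  by apply/(measurable_restrictT f mTA); exact: measurable_funTS.
have := @measurable_fun_fubini_tonelli_G _ _ _ _ _ m1 _ mg (fun z =>
    erestrict_ge0 (fun z _ => f0 z) z).
apply: eq_measurable_fun => y _; rewrite /fubini_G [RHS]integral_mkcond.
by apply: eq_integral => x _; rewrite !patchE in_setX in_setT andbT.
Qed.

End measurable_tonelli.

Section cell.
Context (R : realType).
Local Notation mu n := (lebesgue_rV n : {sigma_finite_measure set 'rV[R]_n -> \bar R}).
Local Notation cell n := (@unit_cell R n).

Lemma measurable_box n (a b : 'I_n -> R) :
  measurable [set x : 'rV[R]_n | forall i, a i < x ord0 i < b i].
Proof.
have -> : [set x : 'rV[R]_n | forall i, a i < x ord0 i < b i] =
    \bigcap_(i in [set: 'I_n]) (coord_rV i @^-1` `]a i, b i[%classic).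
  apply/seteqP; split=> x /= h i; first by move=> _ /=; rewrite in_itv; exact: h.
  by have := h i Logic.I; rewrite /= in_itv.
apply: fin_bigcap_measurable => // i _; rewrite -[X in measurable X]setTI.
exact: measurable_coord_rV.
Qed.

Lemma measurable_unit_cell n : measurable (cell n).
Proof. exact: (@measurable_box n (fun=> 0) (fun=> 1)). Qed.

Lemma cons_rV0 n p : @cons_rV R n p 0 ord0 = p.1.
Proof. exact: cons_rV_head. Qed.

Lemma cons_rVS n p (j : 'I_n) : @cons_rV R n p 0 (lift ord0 j) = p.2 0 j.
Proof. exact: cons_rV_tail. Qed.

Lemma cons_rV_unit_cell n :
  @cons_rV R n @^-1` cell n.+1 = `]0%R, 1%R[%classic `*` cell n.
Proof.
apply/seteqP; split=> -[s x] /=; rewrite in_itv /=.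
  move=> h; split; first by have := h ord0; rewrite cons_rV0.
  by move=> i; have := h (lift ord0 i); rewrite cons_rVS.
move=> [s01 x01] i.
by case: (unliftP ord0 i) => [j ->|->]; rewrite ?cons_rVS ?cons_rV0 //; exact: x01.
Qed.

Section tonelli.
Local Open Scope ereal_scope.
Variables (n : nat) (f : 'rV[R]_n.+1 -> \bar R).
Hypotheses (mf : measurable_fun setT f) (f0 : forall x, 0 <= f x).

Let mfc : measurable_fun setT (f \o @cons_rV R n).
Proof. by apply: measurableT_comp => //; exact: measurable_cons_rV. Qed.

Let cellX : \int[mu n.+1]_(x in cell n.+1) f x =
  \int[(@lebesgue_measure R) \x mu n]_(p in `]0%R,
      1%R[%classic `*` cell n) f (cons_rV p).
Proof.
rewrite -cons_rV_unit_cell -(ge0_integral_pushforward (measurable_cons_rV (n:=n)))//.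
- exact: measurable_unit_cell.
- exact: measurable_funTS.
Qed.

Lemma tonelli_cell1 : \int[mu n.+1]_(x in cell n.+1) f x =
  \int[lebesgue_measure]_(s in `]0%R, 1%R[) \int[mu n]_(x in cell n) f (cons_rV (s, x)).
Proof.
by rewrite cellX (@tonelli_setX1 _ _ _ _ _ lebesgue_measure (mu n))//;
    exact: measurable_unit_cell.
Qed.

Lemma tonelli_cell2 : \int[mu n.+1]_(x in cell n.+1) f x =
  \int[mu n]_(x in cell n) \int[lebesgue_measure]_(s in `]0%R, 1%R[) f (cons_rV (s, x)).
Proof.
by rewrite cellX (@tonelli_setX2 _ _ _ _ _ lebesgue_measure (mu n))//;
    exact: measurable_unit_cell.
Qed.

End tonelli.

Lemma lebesgue_unit_cell n : mu n (cell n) = 1%E.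
Proof.
elim: n => [|n IH].
  by rewrite /= diracE mem_set// => -[].
have -> : mu n.+1 (cell n.+1) = (\int[mu n.+1]_(x in cell n.+1) 1)%E.
  by rewrite integral_cst ?mul1e//; exact: measurable_unit_cell.
rewrite tonelli_cell1//.
have int1 : (\int[mu n]_(x in cell n) 1 = 1)%E.
  by rewrite integral_cst ?mul1e//; exact: measurable_unit_cell.
under eq_integral do rewrite int1.
by rewrite integral_cst//= mul1e lebesgue_measure_itv /= lte01 sube0.
Qed.

(** The sigma-algebra is generated by the coordinates, not by the topology; an open set is the union
    of the countably many rational boxes that it contains. *)
Lemma open_measurable_rV n (U : set 'rV[R]_n) : open U -> measurable U.
Proof.
move=> oU.
pose B (p : 'rV[rat]_n * nat) : set 'rV[R]_n :=
  [set x | forall i, ratr (p.1 0 i) - p.2.+1%:R^-1 < x 0 i < ratr (p.1 0 i) +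
      p.2.+1%:R^-1].
have -> : U = \bigcup_(p in [set p | B p `<=` U]) B p.
  apply/seteqP; split=> [x Ux|x [p /=]]; last exact.
  have /nbhs_ballP[e/= e0 eU] : nbhs x U by exact: open_nbhs_nbhs.
  (* Two points of a box of half-width 1/(k+1) differ by less than 2/(k+1) in each coordinate, so a
     box around x of this size stays in the ball of radius e. *)
  have [k ke] : exists k : nat, 2 * k.+1%:R^-1 < e.
    have e20 : 0 < e / 2 by rewrite divr_gt0.
    have [k _ hk] := near_infty_natSinv_lt (PosNum e20).
    by exists k; have := hk k (leqnn k); rewrite /= ltr_pdivlMr// mulrC.
  have k0 : 0 < k.+1%:R^-1 :> R by rewrite invr_gt0.
  have /choice[q qP] : forall i : 'I_n, exists q : rat,
      x 0 i - k.+1%:R^-1 < ratr q < x 0 i + k.+1%:R^-1.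
    move=> i; have : x 0 i - k.+1%:R^-1 < x 0 i + k.+1%:R^-1 by rewrite ltrD2l gtrN.
    by move=> /rat_in_itvoo[q]; rewrite in_itv /= => h; exists q.
  exists (\row_i q i, k) => /=.
    move=> y yB; apply: eU; split=> // i j; rewrite (ord1 i).
    move: k.+1%:R^-1 ke k0 (qP j) (yB j); rewrite mxE /ball /= =>
        h ke k0 /andP[h1 h2] /andP[h3 h4].
    rewrite ltr_norml; apply/andP; split; lra.
  by move=> i; rewrite mxE; have /andP[] := qP i; move: (k.+1%:R^-1) => h h1 h2;
      apply/andP; split; lra.
rewrite bigcup_mkcond; apply: countable_bigcupT_measurable => [|p].
  exact: countableP.
by case: ifP => // _; exact: measurable_box.
Qed.

Lemma continuous_measurable_rV n (f : 'rV[R]_n -> R) :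
  continuous f -> measurable_fun setT f.
Proof.
move=> cf; apply: (measurability _ (RGenOpens.measurableE R)) => _ [_ [a [b ->] <-]].
rewrite setTI; apply: open_measurable_rV.
by apply: open_comp => [x _|]; [exact: cf|exact: interval_open].
Qed.

End cell.

(** * One-dimensional calculus and slices *)

Section one_dimensional.
Context (R : realType).
Local Notation leb := (@lebesgue_measure R).

Lemma integral_oo_derive1 (F : R -> R) (a b : R) :
  (forall s, derivable F s 1) -> continuous (derive1 F) -> a < b ->
  (\int[leb]_(s in `]a, b[) ((derive1 F) s)%:E = (F b - F a)%:E)%E.
Proof.
move=> dF cF ab.
have mF : measurable_fun setT (derive1 F) by exact: continuous_measurable_fun.
rewrite -(@integral_itv_bndoo _ a b _ true false); last first.
  by apply/measurable_EFinP; exact: measurable_funTS.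
rewrite (@continuous_FTC2 _ (derive1 F) F a b ab); [by rewrite EFinB| | |by []].
  exact: continuous_subspaceT.
have cFs s : {for s, continuous F}.
  by apply: differentiable_continuous; apply/derivable1_diffP; exact: dF.
split=> [s _|//|]; first exact: dF.
  by apply: cvg_at_right_filter; exact: cFs.
by apply: cvg_at_left_filter; exact: cFs.
Qed.

(** The one-dimensional core of the Poincare inequality: the oscillation of g is controlled by its
    derivative, here without the Cauchy-Schwarz inequality. *)
Lemma sqr_le_integral_derive1 (g : R -> R) (s t : R) :
  (forall r, derivable g r 1) -> continuous (derive1 g) ->
  0 < s < 1 -> 0 < t < 1 ->
  ((g s ^+ 2)%:E <= (2 * g t ^+ 2)%:E +
     2%:E * \int[leb]_(r in `]0%R, 1%R[) ((derive1 g) r ^+ 2)%:E)%E.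
Proof.
move=> dg cg s01 t01; set J := (\int[_]_(_ in _) _)%E.
have cg2 : continuous (fun r => (derive1 g) r ^+ 2).
  move=> r; apply: (@continuous_comp _ _ _ (derive1 g) (fun x => x ^+ 2));
      first exact: cg.
  exact: exprn_continuous.
have D2 (a b : R) : 0 < a -> a < b -> b < 1 -> (((g b - g a) ^+ 2)%:E <= J)%E.
  move=> a0 ab b1; set D := g b - g a.
  (* 2 D g' - D^2 <= g'^2, and the left-hand side has the primitive F. *)
  pose F := fun r => 2 * D * g r - D ^+ 2 * r.
  have dF (r : R) : is_derive r (1 : R) F (2 * D * (derive1 g) r - D ^+ 2).
    have Hg : is_derive r (1 : R) g ((derive1 g) r) by rewrite derive1E;
        apply/derivableP.
    have H1 : is_derive r (1 : R) (fun r => 2 * D * g r) (2 * D * (derive1 g) r).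
      exact: (is_deriveZ (2 * D) Hg).
    have H2 : is_derive r (1 : R) (fun r => D ^+ 2 * r) (D ^+ 2).
      by have := is_deriveZ (D ^+ 2) (is_derive_id r (1 : R));
          rewrite /GRing.scale /= mulr1.
    exact: is_deriveB.
  have F'E : (derive1 F) = fun r => 2 * D * (derive1 g) r - D ^+ 2.
    by apply/funext => r; rewrite derive1E; apply: derive_val.
  have cF : continuous (derive1 F).
    rewrite F'E => r; apply: cvgB; last exact: cvg_cst.
    by apply: cvgMr; exact: cg.
  have dF' (r : R) : derivable F r 1 by have [] := dF r.
  have intc (h : R -> R) : continuous h -> leb.-integrable `]a, b[ (EFin \o h).
    move=> ch; have : leb.-integrable `[a, b] (EFin \o h).
      apply: continuous_compact_integrable; first exact: segment_compact.
      exact: continuous_subspaceT.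
    by apply: integrableS => //; exact: subset_itv_oo_cc.
  have FE := integral_oo_derive1 dF' cF ab.
  apply: (@le_trans _ _ (\int[leb]_(s in `]a, b[) ((derive1 F) s)%:E)%E).
    rewrite FE lee_fin /F. 
    (* The increment of F is 2 D^2 - D^2 (b - a), which is at least D^2 because the interval is no
       longer than 1. *)
    have -> : 2 * D * g b - D ^+ 2 * b - (2 * D * g a - D ^+ 2 * a) = D ^+ 2 +
        D ^+ 2 * (1 - (b - a)).
      by rewrite /D; ring.
    by rewrite lerDl mulr_ge0// ?sqr_ge0//; lra.
  apply: (@le_trans _ _ (\int[leb]_(s in `]a, b[) ((derive1 g) s ^+ 2)%:E)%E).
    have le_pt r : ((derive1 F r)%:E <= (derive1 g r ^+ 2)%:E)%E.
      rewrite lee_fin F'E -subr_ge0.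
      have -> : (derive1 g) r ^+ 2 - (2 * D * (derive1 g) r - D ^+ 2) =
          ((derive1 g) r - D) ^+ 2 by ring.
      exact: sqr_ge0.
    have mab : measurable (`]a,
        b[%classic : set (measurableTypeR R)) by exact: measurable_itv.
    exact: (le_integral mab (intc _ cF) (intc _ cg2) (fun r _ => le_pt r)).
  apply: ge0_subset_integral => //.
  - by apply/measurable_EFinP; apply: measurable_funTS;
      exact: continuous_measurable_fun.
  - by move=> r _; rewrite lee_fin sqr_ge0.
  - by move=> r; rewrite /= !in_itv /= => /andP[ar rb]; apply/andP; split; lra.
have {}D2 : (((g s - g t) ^+ 2)%:E <= J)%E.
  case: (ltgtP s t) => [st|ts|->].
  - by rewrite -sqrrN opprB; apply: D2 => //; lra.
  - by apply: D2 => //; lra.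
  - rewrite subrr expr0n /=; apply: integral_ge0 => r _; rewrite lee_fin;
      exact: sqr_ge0.
apply: (@le_trans _ _ ((2 * g t ^+ 2)%:E + 2%:E * ((g s - g t) ^+ 2)%:E)%E).
  rewrite -EFinM -EFinD lee_fin -subr_ge0.
  have -> : 2 * g t ^+ 2 + 2 * (g s - g t) ^+ 2 - g s ^+ 2 =
      (g s - 2 * g t) ^+ 2 by ring.
  exact: sqr_ge0.
by rewrite leeD2l// lee_pmul2l.
Qed.
End one_dimensional.

Section slices.
Context (R : realType).
Local Notation e n i := (delta_mx 0 i : 'rV[R]_n).

Lemma cons_rV_shift0 n (h s : R) (x : 'rV[R]_n) :
  h *: e n.+1 ord0 + cons_rV (s, x) = cons_rV (h *: 1 + s, x).
Proof.
apply/rowP => i; rewrite mxE [X in X + _]mxE [delta_mx _ _ _ _]mxE.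
case: (unliftP ord0 i) => [j ->|->]; rewrite ?cons_rVS ?cons_rV0 //=.
by rewrite mulr0 add0r.
Qed.

Lemma cons_rV_shiftS n j (h s : R) (x : 'rV[R]_n) :
  h *: e n.+1 (lift ord0 j) + cons_rV (s, x) = cons_rV (s, h *: e n j + x).
Proof.
apply/rowP => i; rewrite mxE [X in X + _]mxE [delta_mx _ _ _ _]mxE.
case: (unliftP ord0 i) => [k ->|->];
    rewrite ?cons_rVS ?cons_rV0 /= ?mulr0 ?add0r ?mulr1//.
by rewrite !mxE (inj_eq lift_inj).
Qed.

Lemma continuous_cons_rVl n (x : 'rV[R]_n) : continuous (fun s : R => cons_rV (s, x)).
Proof.
move=> s A /nbhs_ballP[eps /= e0 sA]; apply/nbhs_ballP; exists eps => // t st.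
apply: sA; split=> // i j; rewrite (ord1 i).
by case: (unliftP ord0 j) => [k ->|->]; rewrite ?cons_rVS ?cons_rV0 //=; exact: ballxx.
Qed.

Lemma continuous_cons_rVr n (s : R) : continuous (fun x : 'rV[R]_n => cons_rV (s, x)).
Proof.
move=> x A /nbhs_ballP[eps /= e0 xA]; apply/nbhs_ballP; exists eps => // y [_ xy].
apply: xA; split=> // i j; rewrite (ord1 i).
by case: (unliftP ord0 j) => [k ->|->]; rewrite ?cons_rVS ?cons_rV0 //=; exact: ballxx.
Qed.

Variables (n : nat) (f : 'rV[R]_n.+1 -> R).

(** The difference quotient of f along a coordinate is literally that of a slice, so derivability
    and derivatives transfer without any chain rule. *)
Let quot0 s (x : 'rV[R]_n) :
  (fun h : R => h^-1 *: ((f \o shift (cons_rV (s,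
      x))) (h *: e n.+1 ord0) - f (cons_rV (s, x)))) =
  (fun h : R => h^-1 *: (((fun t : R => f (cons_rV (t,
      x))) \o shift s) (h *: 1) - f (cons_rV (s, x)))).
Proof. by apply/funext => h; rewrite /= cons_rV_shift0. Qed.

Let quotS s (x : 'rV[R]_n) j :
  (fun h : R => h^-1 *: ((f \o shift (cons_rV (s,
      x))) (h *: e n.+1 (lift ord0 j)) - f (cons_rV (s, x)))) =
  (fun h : R => h^-1 *: (((fun y => f (cons_rV (s,
      y))) \o shift x) (h *: e n j) - f (cons_rV (s, x)))).
Proof. by apply/funext => h; rewrite /= cons_rV_shiftS. Qed.

Lemma derivable_slice0 s (x : 'rV[R]_n) : derivable f (cons_rV (s, x)) (e n.+1 ord0) ->
  derivable (fun t : R => f (cons_rV (t, x))) s 1.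
Proof. by rewrite /derivable quot0. Qed.

Lemma derive1_slice0 s (x : 'rV[R]_n) :
  derive1 (fun t : R => f (cons_rV (t, x))) s = partial ord0 f (cons_rV (s, x)).
Proof. by rewrite derive1E /partial /derive quot0. Qed.

Lemma derivable_sliceS s (x : 'rV[R]_n) j : derivable f (cons_rV (s,
    x)) (e n.+1 (lift ord0 j)) ->
  derivable (fun y => f (cons_rV (s, y))) x (e n j).
Proof. by rewrite /derivable quotS. Qed.

Lemma partial_sliceS s (x : 'rV[R]_n) j :
  partial j (fun y => f (cons_rV (s, y))) x = partial (lift ord0 j) f (cons_rV (s, x)).
Proof. by rewrite /partial /derive quotS. Qed.

Lemma Ck1_slice s : Ck 1 f -> Ck 1 (fun y : 'rV[R]_n => f (cons_rV (s, y))).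
Proof.
move=> [cf df]; split=> [x|j].
  by apply: continuous_comp; [exact: continuous_cons_rVr|exact: cf].
have [dj [cj _]] := df (lift ord0 j); split=> [x|].
  exact: derivable_sliceS.
split=> // x; rewrite (_ : partial _ _ = (partial (lift ord0 j) f) \o (fun y =>
    cons_rV (s, y))).
  by apply: continuous_comp; [exact: continuous_cons_rVr|exact: cj].
by apply/funext => y; rewrite partial_sliceS.
Qed.

End slices.

(** * Calculus and the Poincare inequality on the unit cell *)

Section cell_calculus.
Context (R : realType).
Local Notation leb := (@lebesgue_measure R).
Local Notation mu n := (lebesgue_rV n : {sigma_finite_measure set 'rV[R]_n -> \bar R}).
Local Notation cell n := (@unit_cell R n).
Local Notation e n i := (delta_mx 0 i : 'rV[R]_n).

Lemma Ck1_continuous_partial n (f : 'rV[R]_n -> R) i : Ck 1 f ->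
    continuous (partial i f).
Proof. by move=> [_ /(_ i)[_ []]]. Qed.

Lemma Ck1_derivable n (f : 'rV[R]_n -> R) i x : Ck 1 f -> derivable f x (e n i).
Proof. by move=> [_ /(_ i)[]]. Qed.

Lemma Ck1_continuous n (f : 'rV[R]_n -> R) : Ck 1 f -> continuous f.
Proof. by case. Qed.

Lemma continuous_derive1_slice0 n (f : 'rV[R]_n.+1 -> R) x :
  Ck 1 f -> continuous (derive1 (fun s => f (cons_rV (s, x)))).
Proof.
move=> Cf s; rewrite (_ : derive1 _ = partial ord0 f \o (fun s => cons_rV (s, x))).
  by apply: continuous_comp; [exact: continuous_cons_rVl|exact: Ck1_continuous_partial].
by apply/funext => r; rewrite derive1_slice0.
Qed.

Lemma integral_cst_oo (a b : R) (c : \bar R) : a < b ->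
  (\int[leb]_(_ in `]a, b[) c = c * (b - a)%:E)%E.
Proof. by move=> ab; rewrite integral_cst//= lebesgue_measure_itv /= lte_fin ab
    EFinB. Qed.

Lemma integral_cst_cell n (c : \bar R) : (\int[mu n]_(_ in cell n) c = c)%E.
Proof.
rewrite integral_cst; last exact: measurable_unit_cell.
by rewrite -[RHS]mule1 -(lebesgue_unit_cell R n).
Qed.

(* Adding a lower bound makes the integrand nonnegative, so that Tonelli's
   theorem applies without any integrability condition. *)
Lemma integral_partial_cell n i (f : 'rV[R]_n -> R) (M : R) :
  Ck 1 f -> (forall x, f (x + e n i) = f x) -> (forall x, - M <= partial i f x) ->
  (\int[mu n]_(x in cell n) (partial i f x + M)%:E = M%:E)%E.
Proof.
elim: n i f => [[]//|n IH] i f Cf pf Mf.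
have cg : continuous (fun x => partial i f x + M).
  have cp : continuous (partial i f) by exact: Ck1_continuous_partial.
  by move=> x; apply: continuousD; [exact: cp|exact: cst_continuous].
have mg : measurable_fun setT (fun x => (partial i f x + M)%:E).
  by apply/measurable_EFinP; exact: continuous_measurable_rV.
have g0 x : (0 <= (partial i f x + M)%:E)%E.
  by rewrite lee_fin -lerBlDr sub0r.
case: (unliftP ord0 i) => [j|] Ei; subst i.
  rewrite tonelli_cell1//.
  transitivity (\int[leb]_(s in `]0%R, 1%R[) M%:E)%E; last first.
    by rewrite integral_cst_oo// subr0 mule1.
  apply: eq_integral => s _; rewrite -[RHS](IH j (fun y => f (cons_rV (s, y)))).
  - by apply: eq_integral => x _; rewrite partial_sliceS.
  - exact: Ck1_slice.
  - move=> x; rewrite -[RHS]pf; congr f.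
    by rewrite addrC -[e n j]scale1r -cons_rV_shiftS scale1r addrC.
  - by move=> x; rewrite partial_sliceS.
rewrite tonelli_cell2//.
transitivity (\int[mu n]_(x in cell n) M%:E)%E; last first.
  exact: integral_cst_cell.
apply: eq_integral => x _.
(* F is a primitive of the shifted integrand; periodicity cancels the increment of f over a period
   and leaves M. *)
pose F := (fun s : R => f (cons_rV (s, x))) \+ (fun s => M * s).
have dF (s : R) : is_derive s (1 : R) F (partial ord0 f (cons_rV (s, x)) + M).
  apply: is_deriveD.
    rewrite -derive1_slice0 derive1E; apply/derivableP.
    by apply: derivable_slice0; exact: Ck1_derivable.
  by have := is_deriveZ M (is_derive_id s (1 : R)); rewrite /GRing.scale /= mulr1.
have F'E : derive1 F = (fun s => partial ord0 f (cons_rV (s, x)) + M).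
  by apply/funext => s; rewrite derive1E; apply: derive_val.
have := @integral_oo_derive1 _ F 0 1 _ _ ltr01.
rewrite F'E => ->.
- have E1 : f (cons_rV (1, x)) = f (cons_rV (0, x)).
    rewrite -[RHS]pf addrC -[delta_mx _ _]scale1r cons_rV_shift0.
    by rewrite addr0 [_ *: _]mulr1.
  by rewrite /F /= mulr1 mulr0 addr0 E1 addrAC subrr add0r.
- by move=> s; case: (dF s).
- move=> s; apply: (@continuous_comp _ _ _ (fun s => cons_rV (s,
    x)) (fun x => partial ord0 f x + M)).
    exact: continuous_cons_rVl.
  exact: cg.
Qed.

Lemma continuous_sqr (T : topologicalType) (f : T -> R) : continuous f ->
    continuous (fun x => f x ^+ 2).
Proof.
by move=> cf x; apply: (@continuous_comp _ _ _ f (fun y => y ^+ 2));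
    [exact: cf|exact: exprn_continuous].
Qed.

Lemma poincare_cell n (a b : 'I_n -> R) : (forall i, [/\ 0 <= a i,
    a i < b i & b i <= 1]) ->
  exists2 P : R, 0 < P & forall f : 'rV[R]_n -> R, Ck 1 f ->
    (forall x : 'rV[R]_n, (forall i, a i < x 0 i < b i) -> f x = 0) ->
    (\int[mu n]_(x in cell n) (f x ^+ 2)%:E <=
     P%:E * \int[mu n]_(x in cell n) (\sum_(i < n) partial i f x ^+ 2)%:E)%E.
Proof.
elim: n a b => [|n IH] a b ab.
  (* In dimension 0 the box condition is empty, so f vanishes at the only point. *)
  exists 1 => // f _ f0; rewrite integral0_eq => [|x _].
    by rewrite mul1e; apply: integral_ge0 => x _; rewrite big_ord0.
  by rewrite f0 ?expr0n// => -[].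
have [P P0 {}IH] := IH (a \o lift ord0) (b \o lift ord0) (fun i => ab (lift ord0 i)).
have [a0 l0 b1] := ab ord0; set I0 := `]a ord0, b ord0[%classic.
set l := b ord0 - a ord0; have {}l0 : 0 < l by rewrite subr_gt0.
(* Averaging over a side of length l bounds l times the left-hand side by 2 P times the integral for
   the other derivatives plus 2 l times that for the first one; as l <= 1, the factor 2 P + 2 covers
   both. *)
exists ((2 * P + 2) / l); first by rewrite divr_gt0// addr_gt0// mulr_gt0.
move=> f Cf f0.
have mcell := @measurable_unit_cell R n.
have intI0 c : (\int[leb]_(_ in I0) c = c * l%:E)%E by rewrite integral_cst_oo//
    -subr_gt0.
have mI0 : measurable I0 by exact: measurable_itv.
have subI0 : I0 `<=` `]0%R, 1%R[%classic.
  by move=> t; rewrite /I0 /= !in_itv /= => /andP[h1 h2]; apply/andP; split; lra.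
pose F2 (p : R * 'rV[R]_n) := (f (cons_rV p) ^+ 2)%:E.
have mf2 : measurable_fun setT (fun x => (f x ^+ 2)%:E).
  apply/measurable_EFinP; apply: continuous_measurable_rV; apply: continuous_sqr.
  exact: Ck1_continuous.
have mF2 : measurable_fun setT F2.
  by apply: (measurableT_comp mf2); exact: measurable_cons_rV.
have F20 p : (0 <= F2 p)%E by rewrite lee_fin sqr_ge0.
pose d0 (x : 'rV[R]_n.+1) := (partial ord0 f x ^+ 2)%:E.
have md0 : measurable_fun setT d0.
  apply/measurable_EFinP; apply: continuous_measurable_rV; apply: continuous_sqr.
  exact: Ck1_continuous_partial.
have d00 x : (0 <= d0 x)%E by rewrite lee_fin sqr_ge0.
pose dS (x : 'rV[R]_n.+1) := (\sum_(j < n) partial (lift ord0 j) f x ^+ 2)%:E.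
have mdS : measurable_fun setT dS.
  apply/measurable_EFinP; apply: measurable_sum => j.
  apply: continuous_measurable_rV; apply: continuous_sqr.
  exact: Ck1_continuous_partial.
have dS0 x : (0 <= dS x)%E by rewrite lee_fin sumr_ge0// => j _; exact: sqr_ge0.
have mcd0 : measurable_fun setT (d0 \o @cons_rV R n).
  by apply: (measurableT_comp md0); exact: measurable_cons_rV.
have mcdS : measurable_fun setT (dS \o @cons_rV R n).
  by apply: (measurableT_comp mdS); exact: measurable_cons_rV.
have -> : (\int[mu n.+1]_(x in cell n.+1) (\sum_(i < n.+1) partial i f x ^+ 2)%:E =
    \int[mu n.+1]_(x in cell n.+1) d0 x + \int[mu n.+1]_(x in cell n.+1) dS x)%E.
  rewrite -ge0_integralD//; last 3 first.
  - exact: measurable_unit_cell.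
  - exact: measurable_funTS.
  - exact: measurable_funTS.
  by apply: eq_integral => x _; rewrite big_ord_recl EFinD.
pose G x := (\int[leb]_(r in `]0%R, 1%R[) (d0 \o @cons_rV R n) (r, x))%E.
have mG : measurable_fun setT G.
  by apply: (@measurable_integral_fst _ _ _ _ _ leb) => // z; exact: d00.
have G0 x : (0 <= G x)%E by apply: integral_ge0 => r _; exact: d00.
pose H x := (\int[leb]_(t in I0) F2 (t, x))%E.
have mH : measurable_fun setT H.
  by apply: (@measurable_integral_fst _ _ _ _ _ leb).
have H0 x : (0 <= H x)%E by apply: integral_ge0 => r _; exact: F20.
have mF2x x (D : set R) : measurable_fun D (fun t => F2 (t, x)).
  by apply: measurable_funTS; exact: measurableT_comp.
(* Compare f at (s, x) with f at (t, x), average over t in the first side I0 of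
   the box, and apply the induction hypothesis to f (t, .). *)
have step1 (s t : R) x : 0 < s < 1 -> I0 t -> (F2 (s, x) <= 2%:E * F2 (t,
    x) + 2%:E * G x)%E.
  move=> s01 tI.
  have t01 : 0 < t < 1 by have := subI0 _ tI; rewrite /= in_itv.
  have := @sqr_le_integral_derive1 _ (fun s => f (cons_rV (s, x))) s t _ _ s01 t01.
  rewrite EFinM.
  under eq_integral do rewrite derive1_slice0.
  apply.
    by move=> r; apply: derivable_slice0; exact: Ck1_derivable.
  exact: continuous_derive1_slice0.
have step2 (s : R) x : 0 < s < 1 -> (l%:E * F2 (s,
    x) <= 2%:E * H x + (2 * l)%:E * G x)%E.
  move=> s01; rewrite muleC -intI0.
  have -> : (2%:E * H x + (2 * l)%:E * G x = \int[leb]_(t in I0) (2%:E * F2 (t,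
      x) + 2%:E * G x))%E.
    rewrite ge0_integralD//; last 3 first.
    - by move=> t _; rewrite mule_ge0.
    - by apply: measurable_funeM; exact: mF2x.
    - by move=> t _; rewrite mule_ge0.
    rewrite ge0_integralZl//; last exact: mF2x.
    congr (_ + _)%E.
    by apply/esym/(etrans (intI0 _)); rewrite EFinM muleAC.
  apply: ge0_le_integral => //.
  - by apply: emeasurable_funD => //; apply: measurable_funeM; exact: mF2x.
  - by move=> t tI; exact: step1.
have step3 x : (l%:E * \int[leb]_(s in `]0%R, 1%R[) F2 (s,
    x) <= 2%:E * H x + (2 * l)%:E * G x)%E.
  rewrite -ge0_integralZl//; last 2 first.
  - exact: mF2x.
  - by rewrite lee_fin ltW.
  apply: (@le_trans _ _ (\int[leb]_(s in `]0%R,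
      1%R[) (2%:E * H x + (2 * l)%:E * G x))%E).
    apply: ge0_le_integral => //.
    - by move=> s _; rewrite mule_ge0// lee_fin ltW.
    - by apply: measurable_funeM; exact: mF2x.
    - by move=> s /= s01; apply: step2; rewrite in_itv /= in s01.
  by rewrite integral_cst_oo// subr0 mule1.
have step4 : (l%:E * \int[mu n.+1]_(x in cell n.+1) (f x ^+ 2)%:E <=
    2%:E * \int[mu n]_(x in cell n) H x + (2 * l)%:E * \int[mu n]_(x in cell n) G x)%E.
  rewrite tonelli_cell2//; last by move=> x; rewrite lee_fin sqr_ge0.
  pose K x := (\int[leb]_(s in `]0%R, 1%R[) F2 (s, x))%E.
  have mK : measurable_fun (cell n) K.
    by apply: measurable_funTS; apply: (@measurable_integral_fst _ _ _ _ _ leb).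
  have K0 x : cell n x -> (0 <= K x)%E by move=> _; apply: integral_ge0 => s _;
      exact: F20.
  have mHc : measurable_fun (cell n) H by exact: measurable_funTS.
  have mGc : measurable_fun (cell n) G by exact: measurable_funTS.
  have ll0 : (0 <= l%:E)%E by rewrite lee_fin ltW.
  have l20 : (0 <= 2%:E :> \bar R)%E by rewrite lee_fin.
  have ll20 : (0 <= (2 * l)%:E)%E by rewrite lee_fin mulr_ge0// ltW.
  rewrite -/K -(ge0_integralZl _ mcell mK K0 ll0).
  rewrite -(ge0_integralZl _ mcell mHc (fun x _ => H0 x) l20)//.
  rewrite -(ge0_integralZl _ mcell mGc (fun x _ => G0 x) ll20).
  have mH2 : measurable_fun (cell n) (fun x => 2%:E * H x)%E by exact: measurable_funeM.
  have mG2 : measurable_fun (cell n) (fun x =>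
      (2 * l)%:E * G x)%E by exact: measurable_funeM.
  have H20 x : cell n x -> (0 <= 2%:E * H x)%E by rewrite mule_ge0.
  have G20 x : cell n x -> (0 <= (2 * l)%:E * G x)%E by rewrite mule_ge0.
  rewrite -(ge0_integralD _ mcell H20 mH2 G20 mG2).
  apply: ge0_le_integral => //.
  - by move=> x cx; rewrite mule_ge0// K0.
  - by apply: measurable_funeM.
  - exact: emeasurable_funD.
  - by move=> x _; exact: step3.
have HE : (\int[mu n]_(x in cell n) H x <=
    P%:E * \int[mu n.+1]_(x in cell n.+1) dS x)%E.
  (* The order of integration is exchanged: [H] integrates over t for fixed x, whereas the induction
     hypothesis integrates over x for fixed t. *)
  rewrite -(@tonelli_setX2 _ _ _ _ _ leb (mu n))//
      (@tonelli_setX1 _ _ _ _ _ leb (mu n))//.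
  rewrite tonelli_cell1//.
  pose K t := (\int[mu n]_(x in cell n) dS (cons_rV (t, x)))%E.
  have mK : measurable_fun setT K.
    by apply: (@measurable_integral_snd _ _ _ _ _ (mu n) _ _ mcell mcdS) => z;
        exact: dS0.
  have K0 t : (0 <= K t)%E by apply: integral_ge0 => x _; exact: dS0.
  apply: (@le_trans _ _ (\int[leb]_(t in I0) (P%:E * K t))%E); last first.
    rewrite ge0_integralZl//; last 2 first.
    - exact: measurable_funTS.
    - by rewrite lee_fin ltW.
    rewrite lee_pmul2l//; apply: ge0_subset_integral => //.
    exact: measurable_funTS.
  apply: ge0_le_integral => //.
  - by move=> t _; apply: integral_ge0 => x _; exact: F20.
  - by apply: measurable_funTS;
      exact: (@measurable_integral_snd _ _ _ _ _ (mu n) _ _ mcell mF2).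
  - by apply: measurable_funeM; exact: measurable_funTS.
  move=> t tI; have := IH (fun y => f (cons_rV (t, y))) (Ck1_slice t Cf).
  have -> : (\int[mu n]_(x in cell n) (\sum_(i < n) partial i (fun y =>
      f (cons_rV (t, y))) x ^+ 2)%:E = K t)%E.
    by apply: eq_integral => x _; congr EFin; apply: eq_bigr => j _;
        rewrite partial_sliceS.
  apply=> x xb; apply: f0 => i.
  case: (unliftP ord0 i) => [j ->|->]; rewrite ?cons_rVS ?cons_rV0 /=; first exact: xb.
  by move: tI; rewrite /I0 /= in_itv.
have GE : (\int[mu n]_(x in cell n) G x = \int[mu n.+1]_(x in cell n.+1) d0 x)%E.
  by rewrite tonelli_cell2.
have T0 : (0 <= \int[mu n.+1]_(x in cell n.+1) d0 x)%E by apply: integral_ge0.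
have TS : (0 <= \int[mu n.+1]_(x in cell n.+1) dS x)%E by apply: integral_ge0.
rewrite GE in step4.
move: (\int[_]_(_ in _) d0 _)%E (\int[_]_(_ in _) dS _)%E (\int[_]_(_ in _) H _)%E
    T0 TS HE step4.
move=> X Y Z X0 Y0 ZY step4.
rewrite -(@lee_pmul2l _ l%:E)//; apply: (le_trans step4).
rewrite muleA -EFinM (mulrC l) divfK ?gt_eqF//.
rewrite ge0_muleDr// addeC; apply: leeD.
  by apply: lee_wpmul2r => //; rewrite lee_fin; rewrite /l in l0 *; lra.
apply: (@le_trans _ _ (2%:E * (P%:E * Y))%E); first by rewrite lee_pmul2l.
by rewrite muleA -EFinM; apply: lee_wpmul2r => //; rewrite lee_fin; lra.
Qed.


End cell_calculus.

(** * Square-integrable functions *)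

Section square_integrable.
Context d (T : measurableType d) (R : realType).
Variables (mu : {measure set T -> \bar R}) (D : set T).
Hypotheses (mD : measurable D) (muD : (mu D < +oo)%E).
Implicit Types f g h : T -> R.
Local Notation integrable f := (mu.-integrable D (EFin \o f)).

Lemma le_integrable_EFin f g : measurable_fun D f ->
  (forall x, D x -> `|f x| <= g x) -> integrable g -> integrable f.
Proof.
move=> mf fg; apply: le_integrable => //; first exact/measurable_EFinP.
by move=> x Dx /=; rewrite lee_fin (le_trans (fg x Dx))// ler_norm.
Qed.

Lemma integrable_EFinD f g : integrable f -> integrable g ->
  integrable (fun x => f x + g x).
Proof. by move=> If Ig; have := integrableD mD If Ig. Qed.

Lemma integrable_EFinB f g : integrable f -> integrable g ->
  integrable (fun x => f x - g x).
Proof. by move=> If Ig; have := integrableB mD If Ig. Qed.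

Lemma integrable_EFinZ k f : integrable f -> integrable (fun x => k * f x).
Proof. by move=> If; have := integrableZl mD k If. Qed.

Lemma integrable_EFin_sum (I : finType) (f : I -> T -> R) :
  (forall i, integrable (f i)) -> integrable (fun x => \sum_i f i x).
Proof.
move=> If; have := @integrable_sum _ _ _ mu D mD _ (index_enum I) xpredT (fun i =>
    EFin \o f i) (fun i _ => If i).
by apply: eq_integrable => // x _; rewrite /= -sumEFin.
Qed.

Lemma integrable_bounded f M : measurable_fun D f ->
  (forall x, D x -> `|f x| <= M) -> integrable f.
Proof.
move=> mf fM; apply: measurable_bounded_integrable => //.
exists M; split; first exact: num_real.
by move=> K MK x Dx; exact: le_trans (fM x Dx) (ltW MK).
Qed.

Definition sqintegrable f :=
  measurable_fun D f /\ integrable (fun x => f x ^+ 2).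

Lemma sqintegrableM f g : sqintegrable f -> sqintegrable g ->
  integrable (fun x => f x * g x).
Proof.
move=> [mf If] [mg Ig].
apply: (@le_integrable_EFin _ (fun x => f x ^+ 2 + g x ^+ 2)).
- exact: measurable_funM.
- move=> x _; rewrite normrM -(real_normK (num_real (f x))) -(real_normK (num_real
    (g x))).
  by have := sqr_ge0 (`|f x| - `|g x|); have := sqr_ge0 (`|f x| + `|g x|); nra.
- exact: integrable_EFinD.
Qed.

Lemma sqintegrableD f g : sqintegrable f -> sqintegrable g ->
  sqintegrable (fun x => f x + g x).
Proof.
move=> Lf Lg; have Ifg := sqintegrableM Lf Lg; case: Lf Lg => [mf If] [mg Ig].
split; first exact: measurable_funD.
have := integrable_EFinD (integrable_EFinD If Ig) (integrable_EFinZ 2 Ifg).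
by apply: eq_integrable => // x _ /=; congr EFin; ring.
Qed.

Lemma sqintegrableZ k f : sqintegrable f -> sqintegrable (fun x => k * f x).
Proof.
move=> [mf If]; split; first exact: measurable_funM.
have := integrable_EFinZ (k ^+ 2) If.
by apply: eq_integrable => // x _ /=; rewrite exprMn.
Qed.

Lemma sqintegrableB f g : sqintegrable f -> sqintegrable g ->
  sqintegrable (fun x => f x - g x).
Proof.
move=> Lf /(sqintegrableZ (-1)) Lg; have := sqintegrableD Lf Lg.
by under eq_fun do rewrite mulN1r.
Qed.

Lemma bounded_sqintegrable f M : measurable_fun D f ->
  (forall x, D x -> `|f x| <= M) -> sqintegrable f.
Proof.
move=> mf fM; split=> //; apply: (@integrable_bounded _ (M ^+ 2)).
  exact: measurable_funX.
by move=> x Dx; rewrite normrX lerXn2r ?nnegrE// ?fM// (le_trans _ (fM x Dx)).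
Qed.

Lemma sqintegrable_integrable f : sqintegrable f -> integrable f.
Proof.
move=> Lf; have L1 : sqintegrable (cst 1) by apply: (@bounded_sqintegrable _ 1) =>
    // x _; rewrite normr1.
by have := sqintegrableM Lf L1; apply: eq_integrable => // x _ /=; rewrite mulr1.
Qed.

Lemma EFin_Rintegral f : integrable f ->
  (\int[mu]_(x in D) (f x)%:E = (\int[mu]_(x in D) f x)%:E)%E.
Proof. by move=> If; rewrite fineK//; exact: integrable_fin_num. Qed.

(* The truncation argument that replaces an almost everywhere convergent
   subsequence: an integrable function is L^1-close to a bounded one. *)
Lemma integrable_truncation f (eps : R) : integrable f -> 0 < eps ->
  exists k : R, [/\ 0 < k,
    integrable (fun x => if `|f x| <= k then 0 else `|f x|) &
    \int[mu]_(x in D) (if `|f x| <= k then 0 else `|f x|) < eps].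
Proof.
move=> If eps0.
have mf : measurable_fun D f by apply/measurable_EFinP; exact: measurable_int If.
pose g (n : nat) x : R := if `|f x| <= n.+1%:R then 0 else `|f x|.
have mg n : measurable_fun D (g n).
  apply: measurable_fun_if => //.
  - apply: measurable_fun_ler => //; exact: measurableT_comp.
  - by apply: (measurable_funS mD) => //; exact: measurableT_comp.
have Ig n : integrable (g n).
  apply: (@le_integrable_EFin _ (fun x => `|f x|)) => //.
    by move=> x _; rewrite /g; case: ifP; rewrite ?normr0 ?normr_id.
  exact: integrable_norm.
have g0 x : D x -> (EFin \o g n) x @[n --> \oo] --> 0%E.
  move=> _; apply: cvg_near_cst; near=> n; rewrite /= /g ifT//.
  rewrite (le_trans (ltW (truncnS_gt _)))// ler_nat.
  by near: n; exact: nbhs_infty_ge.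
have gf n x : D x -> (`|(g n x)%:E| <= `|f x|%:E)%E.
  by move=> _; rewrite /g /= lee_fin; case: ifP; rewrite ?normr0 ?normr_id.
have [_ _] := dominated_convergence mD (fun n => (measurable_EFinP _ _).2 (mg n))
  (measurable_cst (0 : \bar R)%E) (aeW mu g0) (integrable_norm If)
  (aeW mu (fun x n Dx => gf n x Dx)).
rewrite integral0 => /fine_cvgP[_ /cvgrPdist_lt/(_ _ eps0)[n _ /(_ n (leqnn n))]].
rewrite /= sub0r normrN => ltn; exists n.+1%:R; split=> //; first exact: Ig.
exact: le_lt_trans (ler_norm _) ltn.
Unshelve. all: by end_near. Qed.

End square_integrable.

(** * Periodic functions *)

Section continuous_fun.
Context (R : realType) (T : topologicalType).
Implicit Types f g : T -> R.

Lemma continuous_addf f g : continuous f -> continuous g -> continuous (fun x =>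
    f x + g x).
Proof. by move=> cf cg x; apply: cvgD; [exact: cf|exact: cg]. Qed.

Lemma continuous_mulf f g : continuous f -> continuous g -> continuous (fun x =>
    f x * g x).
Proof. by move=> cf cg x; apply: cvgM; [exact: cf|exact: cg]. Qed.

End continuous_fun.

Section periodic.
Context (R : realType) (d : nat).
Local Notation e i := (delta_mx 0 i : 'rV[R]_d).

Lemma periodicD T (f : 'rV[R]_d -> T) (m : 'I_d -> int) (x : 'rV[R]_d) :
  Defs.periodic f -> f (x + \row_i (m i)%:~R) = f x.
Proof.
move=> pf.
have pfn i (k : nat) y : f (y + k%:R *: e i) = f y.
  elim: k => [|k IH]; first by rewrite scale0r addr0.
  by rewrite -natr1 scalerDl scale1r addrA pf.
have pfz i (k : int) y : f (y + k%:~R *: e i) = f y.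
  case: k => k; first exact: pfn.
  by rewrite NegzE mulrNz scaleNr -[in RHS](subrK (k.+1%:R *: e i) y) pfn.
rewrite [\row_i _]row_sum_delta.
elim: (index_enum _) x => [|i s IH] x; first by rewrite big_nil addr0.
by rewrite big_cons addrA IH mxE pfz.
Qed.

Lemma lattice_translate (x : 'rV[R]_d) :
  exists m : 'I_d -> int, forall i, 0 <= (x + \row_i (m i)%:~R) 0 i < 1.
Proof.
exists (fun i => - Num.floor (x 0 i)) => i; rewrite !mxE mulrNz.
have := floor_itv (x 0 i); rewrite intrD => /andP[h1 h2].
by rewrite subr_ge0 h1 /= ltrBlDr addrC.
Qed.

(** The lattice moves every point into the compact cube [0,1]^d, on which |f| attains its
    maximum. *)
Lemma continuous_periodic_bounded (f : 'rV[R]_d -> R) :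
  continuous f -> Defs.periodic f -> exists2 M, 0 <= M & forall x, `|f x| <= M.
Proof.
move=> cf pf.
pose K := [set x : 'rV[R]_d | forall i, `[0, 1]%classic (x ord0 i)].
have cK : compact K.
  by apply: (@rV_compact R d (fun=> `[0, 1]%classic)) => i; exact: segment_compact.
have K0 : K !=set0 by exists 0 => i; rewrite mxE /= in_itv /= lexx ler01.
have [c _ cmax] := @EVT_max_rV R d (fun x =>
    `|f x|) K K0 cK (continuous_subspaceT (fun x =>
    continuous_comp (cf x) (@norm_continuous _ _ (f x)))).
exists `|f c| => // x; have [m xm] := lattice_translate x.
rewrite -(periodicD m x pf); apply: cmax; rewrite inE => i /=.
by rewrite in_itv /=; have /andP[-> /ltW] := xm i.
Qed.

Lemma periodic_partial (f : 'rV[R]_d -> R) i : Defs.periodic f ->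
    Defs.periodic (partial i f).
Proof.
move=> pf j x; rewrite /partial /derive.
by under eq_fun do rewrite /= addrA !pf.
Qed.

Lemma partialM (f g : 'rV[R]_d -> R) i x : Ck 1 f -> Ck 1 g ->
  partial i (fun x => f x * g x) x = f x * partial i g x + g x * partial i f x.
Proof.
by move=> Cf Cg; rewrite /partial -[LHS]/('D_(e i) (f * g) x) deriveM//;
    exact: Ck1_derivable.
Qed.

Lemma Ck1M (f g : 'rV[R]_d -> R) : Ck 1 f -> Ck 1 g -> Ck 1 (fun x => f x * g x).
Proof.
move=> Cf Cg; split=> [|i].
  by apply: continuous_mulf; exact: Ck1_continuous.
split=> [x|]; first by apply: derivableM; exact: Ck1_derivable.
split=> //; rewrite (_ : partial i _ = fun x => f x * partial i g x +
    g x * partial i f x).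
  have cpf : continuous (partial i f) by exact: Ck1_continuous_partial.
  have cpg : continuous (partial i g) by exact: Ck1_continuous_partial.
  have [cf _] := Cf; have [cg _] := Cg.
  by apply: continuous_addf; exact: continuous_mulf.
by apply/funext => y; rewrite partialM.
Qed.

(** [Ck 1] speaks of partial derivatives only, so the chain rule is applied to the restriction g of
    f to the line through x in direction i, a function of one variable. *)
Lemma is_derive_partial_comp (h h' : R -> R) (f : 'rV[R]_d -> R) i x :
  (forall s : R, is_derive s (1 : R) h (h' s)) -> Ck 1 f ->
  is_derive x (e i) (h \o f) (h' (f x) * partial i f x).
Proof.
move=> hh' Cf; pose g (t : R) := f (t *: e i + x).
have dg : derivable g 0 1 by have /derivable1P : derivable f x (e i) by exact:
    Ck1_derivable.
(* Stated for any outer function k: with [id] it identifies the derivative of g at 0, with h that of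
   the composite. *)
have quot (k : R -> R) : (fun t : R =>
    t^-1 *: (((k \o f) \o shift x) (t *: e i) - (k \o f) x)) =
    (fun t : R => t^-1 *: (((k \o g) \o shift 0) (t *: 1) - (k \o g) 0)).
  apply/funext => t /=.
  by rewrite /g scale0r add0r addr0 [t *: 1]mulr1.
have g0 : g 0 = f x by rewrite /g scale0r add0r.
have dg' : is_derive (0 : R) (1 : R) g (partial i f x).
  have -> : partial i f x = 'D_1 g 0.
    by rewrite /partial /derive -[RHS](congr1 (fun F => lim (F @ 0^')) (quot id)).
  exact/derivableP.
have := @is_derive1_comp _ h g 0 _ _ _ dg'.
rewrite g0 => /(_ _ (hh' _)) [dhg Dhg].
by split; [rewrite /derivable quot|rewrite /derive quot].
Qed.

Lemma Ck1_comp (h h' : R -> R) (f : 'rV[R]_d -> R) :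
  (forall s : R, is_derive s (1 : R) h (h' s)) -> continuous h' -> Ck 1 f ->
      Ck 1 (h \o f).
Proof.
move=> hh' ch' Cf; have [cf _] := Cf.
have ch s : {for s, continuous h}.
  by apply: differentiable_continuous; apply/derivable1_diffP; case: (hh' s).
split=> [x|i]; first by apply: continuous_comp; [exact: cf|exact: ch].
split=> [x|]; first by case: (is_derive_partial_comp i x hh' Cf).
split=> //; rewrite (_ : partial i _ = fun x => h' (f x) * partial i f x).
  apply: continuous_mulf; last exact: Ck1_continuous_partial.
  by move=> x; apply: (@continuous_comp _ _ _ f h'); [exact: cf|exact: ch'].
by apply/funext => y; apply: derive_val; exact: is_derive_partial_comp.
Qed.

End periodic.

(** * Test functions on the fluid part *)

Section test_functions.
Context (R : realType) (d : nat) (E : set 'rV[R]_d).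
Hypothesis oE : open E.
Local Notation e i := (delta_mx 0 i : 'rV[R]_d).
Local Notation mu := (lebesgue_rV d : {sigma_finite_measure set 'rV[R]_d -> \bar R}).
Local Notation cell := (@unit_cell R d).
Local Notation YF := (fluid_cell E).
Implicit Types (phi psi u v : 'rV[R]_d -> R) (Du Dv : 'rV[R]_d -> 'rV[R]_d).

Lemma measurable_fluid_cell : measurable YF.
Proof.
by apply: measurableI; [exact: measurable_unit_cell|exact: open_measurable_rV].
Qed.

Lemma lebesgue_unit_cell_lty : (mu cell < +oo)%E.
Proof. by rewrite [X in (X < _)%E](lebesgue_unit_cell R d) ltry. Qed.

Lemma lebesgue_fluid_cell_lty : (mu YF < +oo)%E.
Proof.
apply: le_lt_trans lebesgue_unit_cell_lty; apply: le_measure.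
- by rewrite inE; exact: measurable_fluid_cell.
- by rewrite inE; exact: measurable_unit_cell.
- exact: subIsetl.
Qed.

Lemma test_function_eq0 phi x : test_function E phi -> ~ E x -> phi x = 0.
Proof.
move=> [_ _ supp] Ex; apply/eqP/negP => /negP px0; apply: Ex; apply: supp.
exact: subset_closure.
Qed.

(** The support is closed and lies in E, so phi vanishes in a whole neighbourhood of x and not only
    at x. *)
Lemma partial_test_function_eq0 phi i x : test_function E phi -> ~ E x ->
  partial i phi x = 0.
Proof.
move=> [_ _ supp] Ex.
have near0 : \forall y \near x, phi y = cst 0 y.
  have : nbhs x (~` closure [set y | phi y != 0]).
    apply: open_nbhs_nbhs; split; last by move=> /supp.
    by apply: closed_openC; exact: closed_closure.
  apply: filterS => y py; apply/eqP/negP => /negP py0; apply: py.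
  exact: subset_closure.
by rewrite /partial (near_eq_derive _ near0) derive_cst.
Qed.

Lemma integral_cell_fluid_cell (g : 'rV[R]_d -> \bar R) : (forall x,
    ~ E x -> g x = 0%E) ->
  (\int[mu]_(x in cell) g x = \int[mu]_(x in YF) g x)%E.
Proof.
move=> g0; rewrite integral_mkcondr; apply: eq_integral => x _.
by rewrite patchE; case: ifPn => // /negP; rewrite inE => /g0.
Qed.

Lemma measurable_test_function phi (D : set 'rV[R]_d) : test_function E phi ->
    measurable_fun D phi.
Proof.
by move=> [Cp _ _]; apply: measurable_funTS; apply: continuous_measurable_rV;
    exact: Ck1_continuous.
Qed.

Lemma measurable_partial_test_function phi i (D : set 'rV[R]_d) : test_function E phi ->
  measurable_fun D (partial i phi).
Proof.
by move=> [Cp _ _]; apply: measurable_funTS; apply: continuous_measurable_rV;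
    exact: Ck1_continuous_partial.
Qed.

Lemma test_function_bounded phi : test_function E phi -> exists M, forall x,
    `|phi x| <= M.
Proof.
move=> [Cp pp _]; have [M _ pM] := continuous_periodic_bounded (Ck1_continuous Cp) pp.
by exists M.
Qed.

Lemma sqintegrable_test_function phi : test_function E phi -> sqintegrable mu YF phi.
Proof.
move=> tp; have [M pM] := test_function_bounded tp.
apply: (@bounded_sqintegrable _ _ _ _ _ measurable_fluid_cell
    lebesgue_fluid_cell_lty _ M) => //.
exact: measurable_test_function.
Qed.

Lemma sqintegrable_partial_test_function phi i :
  test_function E phi -> sqintegrable mu YF (partial i phi).
Proof.
move=> tp; have [Cp pp _] := tp.
have cp : continuous (partial i phi) by exact: Ck1_continuous_partial.
have [M _ pM] := continuous_periodic_bounded cp (periodic_partial i pp).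
apply: (@bounded_sqintegrable _ _ _ _ _ measurable_fluid_cell
    lebesgue_fluid_cell_lty _ M) => //.
exact: measurable_partial_test_function.
Qed.

(** The product is C^1 and 1-periodic, so its partial derivative has integral 0 over the cell:
    opposite faces cancel, although the functions need not vanish there. *)
Lemma integration_by_parts_test_function phi psi i :
  test_function E phi -> test_function E psi ->
  (\int[mu]_(x in YF) (psi x * partial i phi x)%:E =
   - \int[mu]_(x in YF) (partial i psi x * phi x)%:E)%E.
Proof.
move=> tp tq; have [Cp pp _] := tp; have [Cq pq _] := tq.
have mYF := measurable_fluid_cell.
pose chi x := psi x * phi x.
have Cc : Ck 1 chi by exact: Ck1M.
have pc : Defs.periodic chi by move=> j x; rewrite /chi pp pq.
have cc : continuous (partial i chi) by exact: Ck1_continuous_partial.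
have [M _ cM] := continuous_periodic_bounded cc (periodic_partial i pc).
have Ic : mu.-integrable cell (EFin \o partial i chi).
  apply: (@integrable_bounded _ _ _ _ _ (@measurable_unit_cell R d)
      lebesgue_unit_cell_lty _ M) => //.
  by apply: measurable_funTS; exact: continuous_measurable_rV.
have IM : mu.-integrable cell (EFin \o cst M).
  by apply: (@integrable_bounded _ _ _ _ _ (@measurable_unit_cell R d)
      lebesgue_unit_cell_lty _ `|M|).
have int0 : (\int[mu]_(x in cell) (partial i chi x)%:E = 0)%E.
  have lM x : - M <= partial i chi x by have := cM x; rewrite ler_norml => /andP[].
  have := integral_partial_cell Cc (pc i) lM.
  under eq_integral do rewrite EFinD.
  rewrite (integralD (@measurable_unit_cell R d) Ic IM) (integral_cst_cell _ M%:E).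
  rewrite (EFin_Rintegral (@measurable_unit_cell R d) Ic) -EFinD => -[/eqP].
  by rewrite -[X in _ == X]add0r (inj_eq (addIr _)) => /eqP ->.
rewrite integral_cell_fluid_cell in int0; last first.
  move=> x Ex; rewrite partialM// (test_function_eq0 tp Ex) (test_function_eq0 tq Ex).
  by rewrite !mul0r addr0.
have I1 : mu.-integrable YF (EFin \o (fun x => psi x * partial i phi x)).
  by apply: sqintegrableM;
      [exact: mYF|exact: sqintegrable_test_function|exact:
      sqintegrable_partial_test_function].
have I2 : mu.-integrable YF (EFin \o (fun x => partial i psi x * phi x)).
  by apply: sqintegrableM;
      [exact: mYF|exact: sqintegrable_partial_test_function|exact:
      sqintegrable_test_function].
have : (\int[mu]_(x in YF) (psi x * partial i phi x)%:E +
    \int[mu]_(x in YF) (partial i psi x * phi x)%:E = 0)%E.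
  rewrite -int0 -(integralD mYF I1 I2); apply: eq_integral => x _.
  by rewrite partialM//= EFinD (mulrC (phi x)).
rewrite (EFin_Rintegral mYF I1) (EFin_Rintegral mYF I2) -EFinD => -[/eqP].
by rewrite addr_eq0 => /eqP ->.
Qed.

Lemma integrable_density u (Du : 'I_d -> 'rV[R]_d -> R) : sqintegrable mu YF u ->
  (forall i, sqintegrable mu YF (Du i)) ->
  mu.-integrable YF (EFin \o fun x => u x ^+ 2 + \sum_(i < d) Du i x ^+ 2).
Proof.
have mYF := measurable_fluid_cell.
move=> [_ Iu] LDu; apply: integrable_EFinD => //; apply: integrable_EFin_sum => // i.
by case: (LDu i).
Qed.

Lemma H1_weak_gradient_sqintegrable u Du : H1_weak_gradient E u Du ->
  sqintegrable mu YF u /\ forall i, sqintegrable mu YF (fun x => Du x 0 i).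
Proof.
have mYF := measurable_fluid_cell.
move=> [_ mu_ mDu fin _].
have S0 x : 0 <= \sum_(i < d) Du x 0 i ^+ 2 by apply: sumr_ge0 => i _; exact: sqr_ge0.
have Ie : mu.-integrable YF (EFin \o (fun x => u x ^+ 2 + \sum_(i < d) Du x 0 i ^+ 2)).
  apply/integrableP; split.
    apply/measurable_EFinP; apply: measurable_funD; first exact: measurable_funX.
    by apply: measurable_sum => i; exact: measurable_funX.
  move: fin; rewrite /H1_energy; congr (_ < _)%E; apply: eq_integral => x _.
  by rewrite gee0_abs// lee_fin addr_ge0 ?sqr_ge0.
split; first split=> //.
  apply: le_integrable_EFin Ie => //; first exact: measurable_funX.
  by move=> x _; rewrite ger0_norm ?sqr_ge0// lerDl.
move=> i; split=> //; apply: le_integrable_EFin Ie => //; first exact: measurable_funX.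
move=> x _; rewrite ger0_norm ?sqr_ge0// (bigD1 i)//= addrCA lerDl.
by rewrite addr_ge0 ?sqr_ge0// sumr_ge0// => j _; exact: sqr_ge0.
Qed.

Lemma H1_energyE u Du : sqintegrable mu YF u ->
  (forall i, sqintegrable mu YF (fun x => Du x 0 i)) ->
  H1_energy E u Du = (\int[mu]_(x in YF) (u x ^+ 2 + \sum_(i < d) Du x 0 i ^+ 2))%:E.
Proof.
move=> Lu LDu; rewrite /H1_energy (EFin_Rintegral measurable_fluid_cell)//.
exact: (integrable_density (Du := fun i x => Du x 0 i)).
Qed.

Lemma H1_weak_gradient_test_function phi : test_function E phi ->
  H1_weak_gradient E phi (fun x => \row_i partial i phi x).
Proof.
move=> tp; have [_ pp _] := tp.
have Lp := sqintegrable_test_function tp.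
have LDp i : sqintegrable mu YF (fun x => (\row_i partial i phi x) 0 i).
  by under eq_fun do rewrite mxE; exact: sqintegrable_partial_test_function.
split=> //; first by case: Lp.
- by move=> i; case: (LDp i).
- by rewrite H1_energyE// ltry.
move=> psi i tq; rewrite integration_by_parts_test_function//.
by congr (- _)%E; apply: eq_integral => x _; rewrite mxE.
Qed.

Lemma H10_weak_gradient_test_function phi : test_function E phi ->
  H10_weak_gradient E phi (fun x => \row_i partial i phi x).
Proof.
move=> tp; split; first exact: H1_weak_gradient_test_function.
exists (fun=> phi); split=> //.
rewrite [X in X @ _ --> _](_ : _ = cst 0%E); first exact: cvg_cst.
apply/funext => n; rewrite /H1_energy integral0_eq// => x _.
by rewrite subrr expr0n big1 ?addr0// => i _; rewrite !mxE subrr expr0n.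
Qed.

(** This turns the convergence of extended-real energies into one inequality between real integrals,
    the form in which density is used below. *)
Lemma H10_approximation v Dv (eps : R) : H10_weak_gradient E v Dv -> 0 < eps ->
  exists2 phi, test_function E phi &
    \int[mu]_(x in YF) ((v x - phi x) ^+ 2 +
      \sum_(i < d) (Dv x 0 i - partial i phi x) ^+ 2) < eps.
Proof.
move=> [/H1_weak_gradient_sqintegrable[Lv LDv] [phi [tp cvg]]] eps0.
have mYF := measurable_fluid_cell.
have L n := sqintegrableB mYF Lv (sqintegrable_test_function (tp n)).
have LD n i : sqintegrable mu YF (fun x =>
    (\row_i (Dv x 0 i - partial i (phi n) x)) 0 i).
  under eq_fun do rewrite mxE.
  by apply: sqintegrableB => //; exact: sqintegrable_partial_test_function.
move: cvg; under eq_fun do rewrite H1_energyE//.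
move=> /fine_cvgP[_ /cvgrPdist_lt/(_ _ eps0)[n _ /(_ n (leqnn n))]].
rewrite /= sub0r normrN => ltn; exists (phi n) => //.
apply: le_lt_trans ltn; apply: le_trans (ler_norm _).
rewrite le_eqVlt; apply/orP; left; apply/eqP; apply: eq_Rintegral => x _.
by congr (_ + _); apply: eq_bigr => i _; rewrite mxE.
Qed.

End test_functions.

(** * The Poincare inequality on the fluid part *)

Section poincare.
Context (R : realType) (d : nat) (E : set 'rV[R]_d).
Local Notation e i := (delta_mx 0 i : 'rV[R]_d).
Local Notation mu := (lebesgue_rV d : {sigma_finite_measure set 'rV[R]_d -> \bar R}).
Local Notation cell := (@unit_cell R d).
Local Notation YF := (fluid_cell E).

(* Crossing the interface in the direction of a nonzero partial derivative of
   the defining function leads into the solid. *)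
Lemma interior_complement_neq0 : smooth_boundary E -> interface E !=set0 ->
  exists y : 'rV[R]_d, nbhs y (~` E).
Proof.
move=> sE [x Ix]; have [g [sg gx0 [i pg0] Eg]] := sE x Ix.
have Cg : Ck 1 g := sg 1%N.
set c := partial i g x in pg0.
have cg : h^-1 *: (g (h *: e i + x) - g x) @[h --> 0^'] --> c.
  by have := Ck1_derivable (i := i) (x := x) Cg.
have c0 : 0 < `|c| by rewrite normr_gt0.
(* [nbhs_interior] gives the description of E by g on a neighbourhood of every point close to x, in
   particular of the displaced point y. *)
have /nbhs_ballP[r /= r0 rE] := nbhs_interior Eg.
have /cvgrPdist_lt/(_ _ c0) := cg.
move=> /nbhs_ballP[s /= s0 sP].
pose t := Num.min s r / 2.
have t0 : 0 < t by rewrite divr_gt0// lt_min s0 r0.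
have ts : t < s by rewrite ltr_pdivrMr// gt_min; apply/orP; left; lra.
have tr : t < r by rewrite ltr_pdivrMr// gt_min; apply/orP; right; lra.
pose h := Num.sg c * t.
have hn : `|h| = t by rewrite normrM normr_sg pg0 mul1r gtr0_norm.
have h0 : h != 0 by rewrite -normr_gt0 hn.
set y := h *: e i + x.
(* The difference quotient at h is within |c| of c and so has the sign of c; h has that sign by
   construction, hence g y > 0. *)
have gy : 0 < g y.
  have bh : ball (0 : R) s h by rewrite -ball_normE /ball_ /= sub0r normrN hn.
  have := sP h bh h0; rewrite /= gx0 subr0 -/y => cq.
  have qc : 0 < h^-1 * g y * c.
    have : (c - h^-1 * g y) ^+ 2 < c ^+ 2.
      by rewrite -(real_normK (num_real (c - _))) -(real_normK (num_real c)) ltrXn2r.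
    have := sqr_ge0 (h^-1 * g y); nra.
  have : 0 < h^-1 * c.
    rewrite /h invfM mulrAC mulr_gt0 ?invr_gt0//.
    by rewrite invr_sg -normrEsg normr_gt0.
  move=> hc; move: qc; rewrite mulrAC pmulr_rgt0//.
have near_y : nbhs y [set z | E z <-> g z < 0].
  apply: rE; split=> // k j; rewrite (ord1 k) -ball_normE /ball_ /= /y !mxE.
  rewrite opprD addrCA subrr addr0 normrN normrM hn.
  by rewrite normr_nat eqxx /=; case: (j == i); rewrite ?mulr1 ?mulr0.
exists y.
have gpos : \forall z \near y, 0 < g z.
  have cgy : {for y, continuous g} by have [cg' _] := Cg; exact: cg'.
  apply: (cgy [set s | 0 < s]); apply: open_nbhs_nbhs.
  by split=> //; exact: open_gt.
by apply: filterS2 near_y gpos => z Ez gz /Ez; rewrite ltNge ltW.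
Qed.

(** The ball found in the solid may lie outside the cell or cross its faces. Its centre is
    translated into [0,1)^d, and only the part above the centre in every coordinate, cut off at 1,
    is kept: it lies in the closed cell, and its sides are positive because each coordinate of the
    centre is less than 1. *)
Lemma box_in_complement : fluid_domain E -> exists a b : 'I_d -> R,
  (forall i, [/\ 0 <= a i, a i < b i & b i <= 1]) /\
  forall x : 'rV[R]_d, (forall i, a i < x 0 i < b i) -> ~ E x.
Proof.
move=> [_ pE _ sE iE]; have [y /nbhs_ballP[r /= r0 rE]] :=
    interior_complement_neq0 sE iE.
have [m ym] := lattice_translate y.
set y' := y + _ in ym.
exists (fun i => y' 0 i), (fun i => Num.min (y' 0 i + r) 1); split=> [i|x xb].
  have /andP[y0 y1] := ym i; split=> //; last by rewrite ge_min lexx orbT.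
  by rewrite lt_min y1 andbT ltrDl.
pose z := x - \row_i (m i)%:~R.
have <- : E z = E x by rewrite -(periodicD m z pE) subrK.
apply: rE; split=> // k i; rewrite (ord1 k) /ball /= /z.
have := xb i; rewrite lt_min /y' !mxE => /and3P[h1 h2 _].
by rewrite ltr_norml; apply/andP; split; lra.
Qed.

Lemma poincare_test_function : fluid_domain E -> exists2 P : R, 0 < P &
  forall phi, test_function E phi ->
    \int[mu]_(x in YF) (phi x ^+ 2) <=
    P * \int[mu]_(x in YF) (\sum_(i < d) partial i phi x ^+ 2).
Proof.
move=> Ef; have [oE _ _ _ _] := Ef.
have [a [b [ab abE]]] := box_in_complement Ef.
have [P P0 PP] := poincare_cell ab; exists P => // phi tp; have [Cp _ _] := tp.
have mYF := measurable_fluid_cell oE.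
have I1 : mu.-integrable YF (EFin \o (fun x => phi x ^+ 2)).
  by case: (sqintegrable_test_function oE tp).
have I2 : mu.-integrable YF (EFin \o (fun x => \sum_(i < d) partial i phi x ^+ 2)).
  apply: integrable_EFin_sum => // i.
  by case: (sqintegrable_partial_test_function oE i tp).
have := PP phi Cp (fun x xb => test_function_eq0 tp (abE x xb)).
rewrite !(@integral_cell_fluid_cell _ _ E).
- by rewrite (EFin_Rintegral mYF I1) (EFin_Rintegral mYF I2) -EFinM lee_fin.
- move=> x Ex; rewrite big1// => i _.
  by rewrite (partial_test_function_eq0 _ tp Ex) expr0n.
- by move=> x Ex; rewrite (test_function_eq0 tp Ex) expr0n.
Qed.

Lemma poincare_H10 : fluid_domain E -> exists2 P : R, 0 < P &
  forall v Dv, H10_weak_gradient E v Dv ->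
    \int[mu]_(x in YF) (v x ^+ 2) <=
    P * \int[mu]_(x in YF) (\sum_(i < d) Dv x 0 i ^+ 2).
Proof.
move=> Ef; have [oE _ _ _ _] := Ef.
(* The inequality (a + b)^2 <= 2 a^2 + 2 b^2 is used twice, to pass from v to phi and from the
   gradient of phi back to [Dv]: this yields the factor 4 and an error of 4 P + 2 times the squared
   distance. *)
have [P P0 PP] := poincare_test_function Ef; exists (4 * P); first by rewrite mulr_gt0.
move=> v Dv Hv; have [/(H1_weak_gradient_sqintegrable oE)[Lv LDv] _] := Hv.
have mYF := measurable_fluid_cell oE.
apply/ler_addgt0Pr => eps eps0.
have k0 : 0 < 4 * P + 2 by rewrite addr_gt0// mulr_gt0.
have [phi tp dphi] := H10_approximation oE Hv (divr_gt0 eps0 k0).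
have Lp := sqintegrable_test_function oE tp.
have LDp i := sqintegrable_partial_test_function oE i tp.
have := PP phi tp.
set dens := fun x => (v x - phi x) ^+ 2 + _ in dphi.
have Id : mu.-integrable YF (EFin \o dens).
  apply: integrable_EFinD => //; first by case: (sqintegrableB mYF Lv Lp).
  apply: integrable_EFin_sum => // i.
  by case: (sqintegrableB mYF (LDv i) (LDp i)).
have Iv : mu.-integrable YF (EFin \o (fun x => v x ^+ 2)) by case: Lv.
have Ip : mu.-integrable YF (EFin \o (fun x => phi x ^+ 2)) by case: Lp.
have IDv : mu.-integrable YF (EFin \o (fun x => \sum_(i < d) Dv x 0 i ^+ 2)).
  by apply: integrable_EFin_sum => // i; case: (LDv i).
have IDp : mu.-integrable YF (EFin \o (fun x => \sum_(i < d) partial i phi x ^+ 2)).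
  by apply: integrable_EFin_sum => // i; case: (LDp i).
have S0 x : 0 <= \sum_(i < d) (Dv x 0 i - partial i phi x) ^+ 2.
  by apply: sumr_ge0 => i _; exact: sqr_ge0.
have h1 : \int[mu]_(x in YF) (v x ^+ 2) <=
    2 * \int[mu]_(x in YF) dens x + 2 * \int[mu]_(x in YF) (phi x ^+ 2).
  rewrite -!RintegralZl// -RintegralD//; try exact: integrable_EFinZ.
  apply: le_Rintegral => //; first by apply: integrable_EFinD => //;
      exact: integrable_EFinZ.
  move=> x _; rewrite /dens; have := S0 x; have := sqr_ge0 (v x - 2 * phi x); nra.
have h2 : \int[mu]_(x in YF) (\sum_(i < d) partial i phi x ^+ 2) <=
    2 * \int[mu]_(x in YF) dens x + 2 * \int[mu]_(x in YF) (\sum_(i < d) Dv x 0 i ^+ 2).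
  rewrite -!RintegralZl// -RintegralD//; try exact: integrable_EFinZ.
  apply: le_Rintegral => //; first by apply: integrable_EFinD => //;
      exact: integrable_EFinZ.
  move=> x _; rewrite /dens mulrDr -!addrA.
  apply: (@le_trans _ _ (2 * (\sum_(i < d) (Dv x 0 i - partial i phi x) ^+ 2) +
      2 * (\sum_(i < d) Dv x 0 i ^+ 2))).
    rewrite !mulr_sumr -big_split /=; apply: ler_sum => i _.
    have := sqr_ge0 (partial i phi x - 2 * Dv x 0 i); nra.
  by rewrite lerDr mulr_ge0// sqr_ge0.
move=> h3; move: dphi; rewrite ltr_pdivlMr// -/(dens _).
move: (\int[_]_(_ in _) (v _ ^+ 2)) (\int[_]_(_ in _) (\sum_(i < d) Dv _ 0 i ^+ 2))
    (\int[_]_(_ in _) dens _) (\int[_]_(_ in _) (phi _ ^+ 2)) (\int[_]_(_ in _)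
    (\sum_(i < d) partial i phi _ ^+ 2)) h1 h2 h3.
by move=> V DV D F DF h1 h2 h3 h4; nra.
Qed.

End poincare.

(** * Weak equations and the maximum principle *)

Section weak_formulation.
Context (R : realType) (d : nat) (E : set 'rV[R]_d).
Hypothesis oE : open E.
Local Notation mu := (lebesgue_rV d : {sigma_finite_measure set 'rV[R]_d -> \bar R}).
Local Notation YF := (fluid_cell E).
Local Notation integrable f := (mu.-integrable YF (EFin \o f)).
Let mYF := measurable_fluid_cell oE.

Lemma integrable_pairing (A Dv : 'I_d -> 'rV[R]_d -> R) (F v : 'rV[R]_d -> R) :
  (forall i, sqintegrable mu YF (A i)) -> (forall i, sqintegrable mu YF (Dv i)) ->
  integrable (fun x => F x * v x) ->
  integrable (fun x => \sum_(i < d) A i x * Dv i x + F x * v x).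
Proof.
move=> LA LD IF; apply: integrable_EFinD => //; apply: integrable_EFin_sum => // i.
exact: sqintegrableM.
Qed.

(** With square-integrable coefficients the left-hand side is continuous in v for the H^1 norm, so
    density suffices and v may be unbounded. *)
Lemma weak_equation_H10 (A : 'I_d -> 'rV[R]_d -> R) (B v : 'rV[R]_d -> R) Dv :
  (forall i, sqintegrable mu YF (A i)) -> sqintegrable mu YF B ->
  (forall phi, test_function E phi ->
    \int[mu]_(x in YF) (\sum_(i < d) A i x * partial i phi x + B x * phi x) = 0) ->
  H10_weak_gradient E v Dv ->
  \int[mu]_(x in YF) (\sum_(i < d) A i x * Dv x 0 i + B x * v x) = 0.
Proof.
move=> LA LB eqn Hv; have [/(H1_weak_gradient_sqintegrable oE)[Lv LDv] _] := Hv.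
set X := (X in X = 0); pose S x := B x ^+ 2 + \sum_(i < d) A i x ^+ 2.
have IS : integrable S by exact: integrable_density.
have M0 : 0 <= \int[mu]_(x in YF) S x.
  apply: Rintegral_ge0 => x _; rewrite addr_ge0 ?sqr_ge0// sumr_ge0// => i _.
  exact: sqr_ge0.
set M := Rintegral _ _ _ in M0.
apply/eqP; rewrite -normr_le0; apply/ler_addgt0Pr => eps eps0; rewrite add0r.
(* Young's inequality with weights del and 1/del, for phi at squared distance below del^2, leaves
   del M + del = eps. *)
pose del := eps / (M + 1).
have M10 : 0 < M + 1 by rewrite ltr_wpDl.
have del0 : 0 < del by rewrite divr_gt0.
have [phi tp dphi] := H10_approximation oE Hv (mulr_gt0 del0 del0).
have Lp := sqintegrable_test_function oE tp.
have LDp i := sqintegrable_partial_test_function oE i tp.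
set dens := fun x => (v x - phi x) ^+ 2 + _ in dphi.
have Id : integrable dens.
  apply: (integrable_density oE (Du := fun i x => Dv x 0 i - partial i phi x)).
    exact: sqintegrableB.
  by move=> i; exact: sqintegrableB.
have Iv : integrable (fun x => \sum_(i < d) A i x * Dv x 0 i + B x * v x).
  apply: (@integrable_pairing _ (fun i x => Dv x 0 i)) => //.
  exact: sqintegrableM.
have Ip : integrable (fun x => \sum_(i < d) A i x * partial i phi x + B x * phi x).
  by apply: integrable_pairing => //; exact: sqintegrableM.
have XE : X = \int[mu]_(x in YF) (\sum_(i < d) A i x * (Dv x 0 i - partial i phi x)
    + B x * (v x - phi x)).
  rewrite -[LHS]subr0 -[in X in _ - X](eqn phi tp) -RintegralB//;
      apply: eq_Rintegral => x _.
  rewrite opprD addrACA; congr (_ + _); last by rewrite mulrBr.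
  by rewrite -sumrB; apply: eq_bigr => i _; rewrite mulrBr.
have le1 : `|X| <= del * M + del^-1 * \int[mu]_(x in YF) dens x.
  have Iw : integrable (fun x => \sum_(i < d) A i x * (Dv x 0 i - partial i phi x) +
      B x * (v x - phi x)).
    apply: (@integrable_pairing _ (fun i x => Dv x 0 i - partial i phi x)) => //.
      by move=> i; exact: sqintegrableB.
    by apply: sqintegrableM => //; exact: sqintegrableB.
  rewrite XE; apply: le_trans (le_normr_Rintegral mYF Iw) _.
  rewrite -!RintegralZl// -RintegralD//; try exact: integrable_EFinZ.
  apply: le_Rintegral => //.
    exact: integrable_norm.
    by apply: integrable_EFinD => //; exact: integrable_EFinZ.
  have young (a b : R) : `|a * b| <= del * a ^+ 2 + del^-1 * b ^+ 2.
    rewrite normrM -(real_normK (num_real a)) -(real_normK (num_real b)).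
    have /eqP dd : del^-1 == del^-1 ^+ 2 * del by rewrite expr2 -mulrA mulVf
        ?mulr1// gt_eqF.
    have := sqr_ge0 (`|a| - del^-1 * `|b|).
    have -> : del * `|a| ^+ 2 + del^-1 * `|b| ^+ 2 =
       del * (`|a| - del^-1 * `|b|) ^+ 2 + 2 * `|a| * `|b|.
      by rewrite sqrrB; field; rewrite gt_eqF.
    have := mulr_ge0 (normr_ge0 a) (normr_ge0 b); nra.
  move=> x _; apply: le_trans (ler_normD _ _) _.
  rewrite /S /dens (mulrDr del) (mulrDr del^-1) addrACA [leLHS]addrC; apply: lerD;
      first exact: young.
  apply: le_trans (ler_norm_sum _ _ _) _.
  by rewrite !mulr_sumr -big_split /=; apply: ler_sum => i _; exact: young.
apply: (le_trans le1).
have -> : eps = del * M + del by rewrite -[X in _ + X]mulr1 -mulrDr divfK// gt_eqF.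
rewrite lerD2l mulrC ler_pdivrMr//; exact: ltW.
Qed.

(* The equation is tested against h o phi for test functions phi close to u.  As
   Du . grad phi >= - |Du - grad phi|^2 / 4, the gradient term is almost
   nonnegative, and no chain rule in H^1_0 is needed. *)
Lemma weak_maximum_principle (h h' : R -> R) (L : R) (u : 'rV[R]_d ->
    R) Du (F : 'rV[R]_d -> R) :
  (forall s : R, is_derive s (1 : R) h (h' s)) -> continuous h' -> h 0 = 0 ->
  (forall s, 0 <= h' s <= L) -> (forall s, `|h s| <= 1) ->
  (forall s t, `|h s - h t| <= L * `|s - t|) ->
  H10_weak_gradient E u Du -> integrable F ->
  (forall phi, test_function E phi ->
    \int[mu]_(x in YF) (\sum_(i < d) Du x 0 i * partial i phi x + F x * phi x) = 0) ->
  (forall x, 0 <= F x * h (u x)) ->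
  ae_eq mu YF (fun x => (F x * h (u x))%:E) (cst 0%E).
Proof.
move=> hh' ch' h0 h'L h1 hL Hu IF eqn Fh0.
have [/(H1_weak_gradient_sqintegrable oE)[Lu LDu] _] := Hu.
have mF : measurable_fun YF F by apply/measurable_EFinP; exact: measurable_int IF.
have ch : continuous h.
  by move=> s; apply: differentiable_continuous; apply/derivable1_diffP; case: (hh' s).
have mh : measurable_fun setT h by exact: continuous_measurable_fun.
have L0 : 0 <= L by have /andP[a b] := h'L 0; exact: le_trans a b.
have IFh w : measurable_fun YF w -> integrable (fun x => F x * h (w x)).
  move=> mw; apply: (@le_integrable_EFin _ _ _ _ _ mYF _ (fun x => `|F x|)).
  - by apply: measurable_funM => //; exact: measurableT_comp.
  - by move=> x _; rewrite normrM ler_piMr.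
  - exact: integrable_norm.
have IFhu := IFh u Lu.1.
suff int0 : \int[mu]_(x in YF) (F x * h (u x)) <= 0.
  apply/(ae_eq_integral_abs mu mYF); first exact: measurable_int IFhu.
  under eq_integral do rewrite gee0_abs ?lee_fin//.
  rewrite (EFin_Rintegral mYF IFhu); congr EFin; apply/eqP; rewrite eq_le int0 /=.
  exact: Rintegral_ge0.
apply/ler_addgt0Pr => eps eps0; rewrite add0r.
(* The error budget: the tail of F counts twice with eps/8, the constant del integrates to at most
   eps/4, and C times the squared distance is at most eps/4. The height k depends on F and eps only,
   C on k and del, and phi is chosen last. *)
pose m := fine (mu YF).
have m0 : 0 <= m by rewrite fine_ge0.
pose del := eps / (4 * (m + 1)).
have m10 : 0 < 4 * (m + 1) by rewrite mulr_gt0// ltr_wpDl.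
have del0 : 0 < del by rewrite divr_gt0.
have eps8 : 0 < eps / 8 by rewrite divr_gt0.
have [k [k0 Itail tail]] := integrable_truncation mYF IF eps8.
pose C := L + (k * L) ^+ 2 / del.
have C0 : 0 <= C by rewrite addr_ge0// divr_ge0 ?sqr_ge0// ltW.
have C10 : 0 < 4 * (C + 1) by rewrite mulr_gt0// ltr_wpDl.
have [phi tp dphi] := H10_approximation oE Hu (divr_gt0 eps0 C10).
have Lp := sqintegrable_test_function oE tp.
have LDp i := sqintegrable_partial_test_function oE i tp.
set dens := fun x => (u x - phi x) ^+ 2 + _ in dphi.
have Id : integrable dens.
  apply: (integrable_density oE (Du := fun i x => Du x 0 i - partial i phi x)).
    exact: sqintegrableB.
  by move=> i; exact: sqintegrableB.
have [Cp pp sp] := tp.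
have thp : test_function E (h \o phi).
  split; [exact: Ck1_comp hh' ch' Cp|by move=> i x /=; rewrite pp|].
  apply: subset_trans sp; apply: closure_subset => x /=; apply: contra => /eqP ->.
  by rewrite h0.
have Dhp i x : partial i (h \o phi) x = h' (phi x) * partial i phi x.
  by apply: derive_val; exact: is_derive_partial_comp.
pose W x := \sum_(i < d) Du x 0 i * partial i (h \o phi) x + F x * h (phi x).
have IW : integrable W.
  apply: (@integrable_pairing (fun i x => Du x 0 i)) => //.
    by move=> i; exact: sqintegrable_partial_test_function.
  by apply: IFh; case: Lp.
have W0 : \int[mu]_(x in YF) W x = 0 by exact: eqn thp.
pose tl x := if `|F x| <= k then 0 else `|F x|.
have Idel : integrable (fun=> del).
  apply: (@integrable_bounded _ _ _ _ _ mYF (lebesgue_fluid_cell_lty oE) _ del) => //.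
  by move=> x _; rewrite gtr0_norm.
have pointwise x : F x * h (u x) <= W x + (2 * tl x + (del + C * dens x)).
  pose D := \sum_(i < d) (Du x 0 i - partial i phi x) ^+ 2.
  have D0 : 0 <= D by apply: sumr_ge0 => i _; exact: sqr_ge0.
  have grad : - (L * D) <= \sum_(i < d) Du x 0 i * partial i (h \o phi) x.
    rewrite /D mulr_sumr -sumrN; apply: ler_sum => i _; rewrite Dhp.
    have /andP[h'0 h'x] := h'L (phi x).
    have := sqr_ge0 (Du x 0 i + partial i phi x);
        have := sqr_ge0 (Du x 0 i - partial i phi x).
    move: (Du x 0 i) (partial i phi x) (h' (phi x)) h'0 h'x => a b c c0 cL ab0 ab1.
    rewrite -subr_ge0 opprK.
    have -> : a * (c * b) + L * (a - b) ^+ 2 =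
        c / 4 * (a + b) ^+ 2 + (L - c / 4) * (a - b) ^+ 2 by field.
    rewrite addr_ge0// mulr_ge0//; first by rewrite divr_ge0.
    lra.
  (* Where |F| <= k, the Lipschitz bound for h and Young's inequality apply; where |F| > k, the two
     values of h differ by at most 2. *)
  have low : F x * (h (u x) - h (phi x)) <= 2 * tl x + (del +
      (k * L) ^+ 2 / del * (u x - phi x) ^+ 2).
    apply: (le_trans (ler_norm _)); rewrite normrM /tl; case: ifPn => Fk.
      rewrite mulr0 add0r; apply: (@le_trans _ _ (k * L * `|u x - phi x|)).
        by rewrite -mulrA ler_pM.
      rewrite -(real_normK (num_real (u x - phi x))) -subr_ge0.
      set w := `|_|; set kL := k * L.
      have -> : del + kL ^+ 2 / del * w ^+ 2 - kL * w =
          ((del - kL * w / 2) ^+ 2 + 3 / 4 * (kL * w) ^+ 2) / del.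
        by field; rewrite gt_eqF.
      apply: divr_ge0; last exact: ltW.
      by rewrite addr_ge0 ?sqr_ge0// mulr_ge0 ?sqr_ge0// divr_ge0.
    apply: (@le_trans _ _ (2 * `|F x|)).
      rewrite mulrC ler_wpM2r//; apply: le_trans (ler_normB _ _) _.
      by have := h1 (u x); have := h1 (phi x); lra.
    rewrite lerDl; apply: addr_ge0; first exact: ltW.
    by apply: mulr_ge0; rewrite ?sqr_ge0// divr_ge0 ?sqr_ge0// ltW.
  have w0 : 0 <= (u x - phi x) ^+ 2 by exact: sqr_ge0.
  have Cdens : L * D + (k * L) ^+ 2 / del * (u x - phi x) ^+ 2 <= C * dens x.
    have kL0 : 0 <= (k * L) ^+ 2 / del by rewrite divr_ge0 ?sqr_ge0// ltW.
    rewrite /C /dens -/D; move: ((k * L) ^+ 2 / del) kL0 => c c0.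
    have := mulr_ge0 L0 w0; have := mulr_ge0 c0 D0; lra.
  by rewrite /W; move: low; rewrite mulrBr; lra.
have I3 : integrable (fun x => del + C * dens x).
  by apply: integrable_EFinD => //; exact: integrable_EFinZ.
have I2 : integrable (fun x => 2 * tl x) by exact: integrable_EFinZ.
apply: (@le_trans _ _ (\int[mu]_(x in YF) (W x + (2 * tl x + (del + C * dens x))))).
  apply: le_Rintegral => //.
  by apply: integrable_EFinD => //; exact: integrable_EFinD.
have -> : \int[mu]_(x in YF) (W x + (2 * tl x + (del + C * dens x))) =
    2 * \int[mu]_(x in YF) tl x + (del * m + C * \int[mu]_(x in YF) dens x).
  rewrite (RintegralD mYF IW (integrable_EFinD mYF I2 I3)) (RintegralD mYF I2 I3).
  rewrite (RintegralD mYF Idel (integrable_EFinZ mYF C Id)).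
  rewrite -[RHS]add0r; congr (_ + (_ + (_ + _))).
  - exact: W0.
  - exact: RintegralZl.
  - exact: Rintegral_cst.
  - exact: RintegralZl.
have delm : del * m <= eps / 4.
  rewrite /del invfM !mulrA -mulrA -[leRHS]mulr1 ler_pM2l ?divr_gt0//
      mulrC ler_pdivrMr ?ltr_wpDl//; lra.
have Cd : C * \int[mu]_(x in YF) dens x <= eps / 4.
  apply: (@le_trans _ _ (C * (eps / (4 * (C + 1))))); first by rewrite ler_wpM2l// ltW.
  have -> : C * (eps / (4 * (C + 1))) = eps / 4 * (C / (C + 1)).
    by field; rewrite gt_eqF// ltr_wpDl.
  by rewrite ler_piMr ?divr_ge0// ?ler_pdivrMr ?ltr_wpDl//; lra.
by move: tail; rewrite -/tl; lra.
Qed.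

End weak_formulation.

(** * The barrier and the nonlinearity *)

Section barrier.
Context (R : realType).

(** The square makes the positive part C^1, as composition with test functions requires. *)
Definition pos_sqr (r : R) : R := Num.max r 0 ^+ 2.

Lemma is_derive_pos_sqr (r : R) : is_derive r (1 : R) pos_sqr (2 * Num.max r 0).
Proof.
have [r0|r0|->] := ltgtP r 0.
- have e : {near r, cst 0 =1 pos_sqr}.
    near=> s; rewrite /pos_sqr max_r ?expr0n//.
    by apply: ltW; near: s; exact: lt_nbhsl.
  rewrite mulr0; apply: (near_eq_is_derive e).
- have e : {near r, (fun s : R => s ^+ 2) =1 pos_sqr}.
    near=> s; rewrite /pos_sqr max_l//.
    by apply: ltW; near: s; exact: lt_nbhsr.
  apply: (near_eq_is_derive e).
  by have := is_deriveX 2 (is_derive_id r (1 : R)); rewrite /GRing.scale /= mulr1 expr1.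
rewrite mulr0.
(* At the kink the difference quotient is at most |h| in absolute value. *)
have cv : h^-1 *: ((pos_sqr \o shift 0) (h *: 1) - pos_sqr 0) @[h --> 0^'] --> (0 : R).
  apply/cvgrPdist_le => eps eps0; near=> h.
  have h0 : h != 0 by near: h; exact: nbhs_dnbhs_neq.
  have he : `|h| <= eps by near: h; apply: dnbhs0_le.
  rewrite sub0r normrN /= addr0 [h *: 1]mulr1 /pos_sqr maxxx expr0n subr0 normrM normfV.
  rewrite ler_pdivrMl ?normr_gt0// normrX (le_trans _ (ler_wpM2l (normr_ge0 h) he))//.
  rewrite expr2 ler_pM//; case: (leP h 0) => h0'; rewrite ?normr0//.
apply: DeriveDef; first by apply/cvg_ex; exists 0.
exact: cvg_lim.
Unshelve. all: by end_near. Qed.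

Lemma continuous_max0 : continuous (fun r : R => Num.max r 0).
Proof.
move=> r; rewrite (_ : (fun _ => _) = fun r : R => (r + `|r|) * 2^-1); last first.
  by apply/funext => s; rewrite maxr_absE addr0 subr0.
apply: cvgM; last exact: cvg_cst.
by apply: cvgD; [exact: cvg_id|exact: norm_continuous].
Qed.

(** This is p / (1 + p) with p = [pos_sqr r]: a C^1 function with values in [0,1), zero for r <= 0
    and positive for r > 0. *)
Let soft (r : R) : R := 1 - (1 + pos_sqr r)^-1.
Let dsoft (r : R) : R := (1 + pos_sqr r) ^- 2 * (2 * Num.max r 0).

Let pos_sqr_ge0 r : 0 <= pos_sqr r.
Proof. exact: sqr_ge0. Qed.

Let pos_sqr1_gt0 r : 0 < 1 + pos_sqr r.
Proof. exact: ltr_pwDl. Qed.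

Let is_derive_soft (r : R) : is_derive r (1 : R) soft (dsoft r).
Proof.
have H1 : is_derive r (1 : R) (fun s => 1 + pos_sqr s) (2 * Num.max r 0).
  by have := is_deriveD (is_derive_cst (1 : R) r (1 : R)) (is_derive_pos_sqr r);
      rewrite add0r.
have := is_deriveB (is_derive_cst (1 : R) r (1 : R)) (@is_deriveV _ (fun s => 1 +
    pos_sqr s) r _ _ (lt0r_neq0 (pos_sqr1_gt0 r)) H1).
by rewrite sub0r scaleNr opprK.
Qed.

Let continuous_dsoft : continuous dsoft.
Proof.
move=> r; apply: cvgM.
  apply: cvgV; first by rewrite expf_neq0// gt_eqF.
  apply: (@continuous_comp _ _ _ (fun s => 1 + pos_sqr s) (fun s => s ^+ 2));
      last exact: exprn_continuous.
  apply: cvgD; first exact: cvg_cst.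
  apply: (@continuous_comp _ _ _ (fun s : R => Num.max s 0) (fun s => s ^+ 2));
      last exact: exprn_continuous.
  exact: continuous_max0.
by apply: cvgM; [exact: cvg_cst|exact: continuous_max0].
Qed.

Let dsoft_bound r : 0 <= dsoft r <= 2.
Proof.
have m0 : 0 <= Num.max r 0 by rewrite le_max lexx orbT.
rewrite /dsoft /pos_sqr; move: (Num.max r 0) m0 => m m0.
have p0 : 0 < (1 + m ^+ 2) ^+ 2 by rewrite exprn_gt0// ltr_pwDl// sqr_ge0.
apply/andP; split; first by rewrite mulr_ge0 ?mulr_ge0// invr_ge0 ltW.
rewrite mulrC ler_pdivrMr//.
have := sqr_ge0 m; have := sqr_ge0 (m - 1); have := sqr_ge0 (m ^+ 2); nra.
Qed.

Let soft_bound r : 0 <= soft r < 1.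
Proof.
rewrite /soft subr_ge0 invf_le1// lerDl pos_sqr_ge0 /=.
by rewrite ltrBlDr ltrDl invr_gt0.
Qed.

Let soft_eq0 r : r <= 0 -> soft r = 0.
Proof. by move=> r0; rewrite /soft /pos_sqr max_r// expr0n addr0 invr1 subrr. Qed.

Let soft_gt0 r : 0 < r -> 0 < soft r.
Proof.
move=> r0; rewrite /soft subr_gt0 invf_lt1// ltrDl /pos_sqr max_l ?ltW//.
by rewrite exprn_gt0.
Qed.

(* It vanishes on [-K, K]; for K = |zeta| it thus has the sign of
   Phi (zeta + s) wherever it does not vanish. *)
Definition barrier (K s : R) : R := soft (s - K) - soft (- s - K).

Definition dbarrier (K s : R) : R := dsoft (s - K) + dsoft (- s - K).

Lemma is_derive_barrier (K s : R) : is_derive s (1 : R) (barrier K) (dbarrier K s).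
Proof.
have H1 : is_derive s (1 : R) (fun s => s - K) 1.
  by have := is_deriveB (is_derive_id s (1 : R)) (is_derive_cst K s (1 : R));
      rewrite subr0.
have H2 : is_derive s (1 : R) (fun s => - s - K) (- 1).
  by have := is_deriveB (is_deriveNid s (1 : R)) (is_derive_cst K s (1 : R));
      rewrite subr0.
have := is_deriveB (@is_derive1_comp _ _ _ _ _ _ (is_derive_soft _) H1)
  (@is_derive1_comp _ _ _ _ _ _ (is_derive_soft _) H2).
by rewrite mulr1 mulrN1 opprK.
Qed.

Lemma continuous_dbarrier (K : R) : continuous (dbarrier K).
Proof.
move=> s; apply: cvgD.
  apply: (@continuous_comp _ _ _ (fun s => s - K) dsoft); last exact: continuous_dsoft.
  by apply: cvgB; [exact: cvg_id|exact: cvg_cst].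
apply: (@continuous_comp _ _ _ (fun s => - s - K) dsoft); last exact: continuous_dsoft.
by apply: cvgB; [apply: cvgN; exact: cvg_id|exact: cvg_cst].
Qed.

Lemma dbarrier_bound (K s : R) : 0 <= dbarrier K s <= 4.
Proof.
rewrite /dbarrier; have := dsoft_bound (s - K); have := dsoft_bound (- s - K).
by move=> /andP[a b] /andP[c e]; apply/andP; split; lra.
Qed.

Lemma barrier_bound (K s : R) : `|barrier K s| <= 1.
Proof.
rewrite /barrier; have := soft_bound (s - K); have := soft_bound (- s - K).
by move=> /andP[a b] /andP[c e]; rewrite ler_norml; apply/andP; split; lra.
Qed.

Lemma barrier_eq0 (K s : R) : `|s| <= K -> barrier K s = 0.
Proof.
rewrite ler_norml => /andP[a b]; rewrite /barrier !soft_eq0 ?subrr//; lra.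
Qed.

Lemma barrier_gt0 (K s : R) : 0 <= K -> K < s -> 0 < barrier K s.
Proof.
by move=> K0 Ks; rewrite /barrier (@soft_eq0 (- s - K)) ?subr0 ?soft_gt0//; lra.
Qed.

Lemma barrier_lt0 (K s : R) : 0 <= K -> s < - K -> barrier K s < 0.
Proof.
by move=> K0 Ks; rewrite /barrier (@soft_eq0 (s - K)) ?sub0r ?oppr_lt0 ?soft_gt0//; lra.
Qed.

Lemma barrier_lipschitz (K s t : R) : `|barrier K s - barrier K t| <= 4 * `|s - t|.
Proof.
wlog st : s t / t <= s => [H|].
  have /orP[ts|st] := le_total t s; first exact: H.
  by rewrite (distrC (barrier K s)) (distrC s); exact: H.
have cb : {within `[t, s], continuous (barrier K)}.
  apply: continuous_subspaceT => x; apply: differentiable_continuous.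
  by apply/derivable1_diffP; case: (is_derive_barrier K x).
have [c _ ->] := MVT_segment st (fun x _ => is_derive_barrier K x) cb.
have /andP[d0 d4] := dbarrier_bound K c.
by rewrite normrM ler_wpM2r// ger0_norm.
Qed.

End barrier.

Section Phi.
Context (R : realType) (N : nat) (z : 'I_N.+1 -> int) (n0 : 'I_N.+1 -> R).
Hypothesis n0_gt0 : forall j, 0 < n0 j.

(** The derivative in the variable is - w^2 c exp(- w s), which is nonpositive whatever the sign of
    w. *)
Let Phi_term_decr (w c s t : R) : 0 < c -> s <= t ->
  w * c * expR (- w * t) <= w * c * expR (- w * s).
Proof.
move=> c0 st; have [w0|w0] := lerP 0 w.
  by apply: ler_wpM2l; [rewrite mulr_ge0// ltW|rewrite ler_expR; nra].
by apply: ler_wnM2l; [rewrite nmulr_rle0// ltW|rewrite ler_expR; nra].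
Qed.

Lemma Phi_incr s t : s <= t -> Phi z n0 s <= Phi z n0 t.
Proof.
by move=> st; rewrite /Phi lerN2; apply: ler_sum => j _; exact: Phi_term_decr.
Qed.

Hypothesis z_first : z ord0 < 0.
Hypothesis n0_neutral : \sum_(j < N.+1) (z j)%:~R * n0 j = 0.

Lemma Phi0 : Phi z n0 0 = 0.
Proof.
rewrite /Phi; under eq_bigr do rewrite mulr0 expR0 mulr1.
by rewrite n0_neutral oppr0.
Qed.

(** The term of the first charge, which is nonzero, is strictly monotone; the others contribute
    monotonically. *)
Lemma Phi_strict_incr s t : s < t -> Phi z n0 s < Phi z n0 t.
Proof.
move=> st; rewrite /Phi ltrN2 [ltLHS](bigD1 ord0)//= [ltRHS](bigD1 ord0)//=.
apply: ltr_leD; last by apply: ler_sum => j _; apply: Phi_term_decr => //; exact: ltW.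
have w0 : (z ord0)%:~R < 0 :> R by rewrite ltrz0.
by rewrite ltr_nM2l ?nmulr_rlt0// ltr_expR; nra.
Qed.

Lemma Phi_lipschitz (M : R) : exists2 L : R, 0 < L &
  forall s t, `|s| <= M -> `|t| <= M -> `|Phi z n0 s - Phi z n0 t| <= L * `|s - t|.
Proof.
(* For |s| <= M the exponent is at most |z_j| M, where exp has slope at most exp(|z_j| M); the last
   factor is the slope of the exponent. *)
pose Lj j : R := `|(z j)%:~R * n0 j| * (expR (`|(z j)%:~R| * M) * `|(z j)%:~R|).
have Lj0 j : 0 <= Lj j by rewrite !mulr_ge0 ?expR_ge0.
exists (1 + \sum_(j < N.+1) Lj j); first by rewrite ltr_pwDl// sumr_ge0.
move=> s t sM tM.
have lipexp (a b m : R) : a <= m -> b <= m -> `|expR a - expR b| <= expR m * `|a - b|.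
  wlog ab : a b / b <= a => [H am bm|am bm].
    have /orP[ba|ab] := le_total b a; first exact: H.
    by rewrite (distrC (expR a)) (distrC a); exact: H.
  rewrite !ger0_norm ?subr_ge0 ?ler_expR//.
  apply: (@le_trans _ _ (expR a * (a - b))); last by rewrite ler_wpM2r ?subr_ge0//
      ler_expR.
  (* The tangent inequality 1 + (b - a) <= exp(b - a), multiplied by exp a, bounds the increment by
     the slope at the larger endpoint. *)
  have := expR_ge1Dx (b - a); rewrite -(ler_pM2l (expR_gt0 a)) -expRD (addrC a) subrK.
  lra.
rewrite /Phi -opprD normrN -sumrB; apply: le_trans (ler_norm_sum _ _ _) _.
apply: (@le_trans _ _ ((\sum_(j < N.+1) Lj j) * `|s - t|));
    last by rewrite ler_wpM2r// lerDr.
rewrite mulr_suml; apply: ler_sum => j _; rewrite -mulrBr normrM /Lj -mulrA ler_wpM2l//.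
have zM (r : R) : `|r| <= M -> - (z j)%:~R * r <= `|(z j)%:~R| * M.
  by move=> rM; apply: le_trans (ler_norm _) _; rewrite normrM normrN ler_wpM2l.
apply: le_trans (lipexp _ _ _ (zM s sM) (zM t tM)) _.
by rewrite -mulrBr normrM normrN mulrA.
Qed.

End Phi.

(** * Linear combinations in H^1_0 *)

Section H10_linear.
Context (R : realType) (d : nat) (E : set 'rV[R]_d).
Hypothesis oE : open E.
Local Notation mu := (lebesgue_rV d : {sigma_finite_measure set 'rV[R]_d -> \bar R}).
Local Notation YF := (fluid_cell E).
Local Notation integrable f := (mu.-integrable YF (EFin \o f)).
Let mYF := measurable_fluid_cell oE.

Lemma H1_weak_gradientB (u v : 'rV[R]_d -> R) Du Dv (c : R) :
  H1_weak_gradient E u Du -> H1_weak_gradient E v Dv ->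
  H1_weak_gradient E (fun x => u x - c * v x) (fun x => Du x - c *: Dv x).
Proof.
move=> Hu Hv.
have [Lu LDu] := H1_weak_gradient_sqintegrable oE Hu.
have [Lv LDv] := H1_weak_gradient_sqintegrable oE Hv.
have [pu _ _ _ wu] := Hu; have [pv _ _ _ wv] := Hv.
have Lw : sqintegrable mu YF (fun x => u x - c * v x).
  by apply: sqintegrableB => //; exact: sqintegrableZ.
have LDw i : sqintegrable mu YF (fun x => (Du x - c *: Dv x) 0 i).
  rewrite (_ : (fun x => (Du x - c *: Dv x) 0 i) = fun x => Du x 0 i - c * Dv x 0 i).
    by apply: sqintegrableB => //; exact: sqintegrableZ.
  by apply/funext => x; rewrite !mxE.
split.
- by move=> i x; rewrite pu pv.
- by case: Lw.
- by move=> i; case: (LDw i).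
- by rewrite H1_energyE// ltry.
move=> phi i tp.
have Lp := sqintegrable_test_function oE tp.
have LDp := sqintegrable_partial_test_function oE i tp.
have wR (f g : 'rV[R]_d -> R) : sqintegrable mu YF f -> sqintegrable mu YF g ->
    (\int[mu]_(x in YF) (f x * partial i phi x)%:E =
        - \int[mu]_(x in YF) (g x * phi x)%:E)%E <->
    \int[mu]_(x in YF) (f x * partial i phi x) = - \int[mu]_(x in YF) (g x * phi x).
  move=> Lf Lg; rewrite (EFin_Rintegral mYF (sqintegrableM mYF Lf LDp)).
  rewrite (EFin_Rintegral mYF (sqintegrableM mYF Lg Lp)) -EFinN.
  by split=> [[]|->].
apply/wR => //; have /wR Eu := wu phi i tp; have /wR Ev := wv phi i tp.
under eq_Rintegral do rewrite mulrBl -mulrA.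
under [in RHS]eq_Rintegral do rewrite !mxE mulrBl -mulrA.
have Iu := sqintegrableM mYF Lu LDp; have Iv := sqintegrableM mYF Lv LDp.
have IDu := sqintegrableM mYF (LDu i) Lp; have IDv := sqintegrableM mYF (LDv i) Lp.
rewrite (RintegralB mYF Iu (integrable_EFinZ mYF c Iv)).
rewrite (RintegralB mYF IDu (integrable_EFinZ mYF c IDv)).
by rewrite !RintegralZl// Eu// Ev// opprB mulrN opprK addrC.
Qed.

Lemma partialB (f g : 'rV[R]_d -> R) (c : R) i x : Ck 1 f -> Ck 1 g ->
  partial i (fun y => f y - c * g y) x = partial i f x - c * partial i g x.
Proof.
move=> Cf Cg.
have df : derivable f x (delta_mx 0 i) by exact: Ck1_derivable.
have dg : derivable g x (delta_mx 0 i) by exact: Ck1_derivable.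
have -> : (fun y => f y - c * g y) = f - c *: g by [].
by rewrite /partial (deriveB df (derivableZ dg)) (deriveZ _ dg).
Qed.

Lemma test_functionB phi psi (c : R) : test_function E phi -> test_function E psi ->
  test_function E (fun x => phi x - c * psi x).
Proof.
move=> [Cp pp sp] [Cq pq sq].
have linE (f g : 'rV[R]_d -> R) : (fun y => f y - c * g y) = fun y => f y + - c * g y.
  by apply/funext => y; rewrite mulNr.
split.
- have [cp _] := Cp; have [cq _] := Cq; split=> [|i].
    rewrite linE; apply: continuous_addf => //; apply: continuous_mulf => // x.
    exact: cst_continuous.
  have dp x : derivable phi x (delta_mx 0 i) by exact: Ck1_derivable.
  have dq x : derivable psi x (delta_mx 0 i) by exact: Ck1_derivable.
  split=> [x|].
    have -> : (fun y => phi y - c * psi y) = phi - c *: psi by [].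
    by apply: derivableB => //; exact: derivableZ.
  have -> : partial i (fun y => phi y - c * psi y) = fun x =>
      partial i phi x - c * partial i psi x.
    by apply/funext => x; rewrite partialB.
  split=> //; rewrite linE.
  have cdp : continuous (partial i phi) by exact: Ck1_continuous_partial.
  have cdq : continuous (partial i psi) by exact: Ck1_continuous_partial.
  apply: continuous_addf => //; apply: continuous_mulf => // x.
  exact: cst_continuous.
- by move=> i x; rewrite pp pq.
- apply: (@subset_trans _ (closure ([set x | phi x != 0] `|` [set x | psi x != 0]))).
    apply: closure_subset => x /=; apply: contraPP => /not_orP[/negP/negPn/eqP ->
        /negP/negPn/eqP ->].
    by rewrite mulr0 subrr eqxx.
  by rewrite closureU => x [/sp|/sq].
Qed.

Lemma H10_weak_gradientB (u v : 'rV[R]_d -> R) Du Dv (c : R) :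
  H10_weak_gradient E u Du -> H10_weak_gradient E v Dv ->
  H10_weak_gradient E (fun x => u x - c * v x) (fun x => Du x - c *: Dv x).
Proof.
move=> Hu Hv; have [Hu1 _] := Hu; have [Hv1 _] := Hv.
have Hw := H1_weak_gradientB c Hu1 Hv1; split=> //.
have [Lw LDw] := H1_weak_gradient_sqintegrable oE Hw.
have approx (eps : R) : 0 < eps -> exists2 chi, test_function E chi &
    \int[mu]_(x in YF) ((u x - c * v x - chi x) ^+ 2 +
      \sum_(i < d) ((Du x - c *: Dv x) 0 i - partial i chi x) ^+ 2) < eps.
  move=> eps0.
  have [Lu LDu] := H1_weak_gradient_sqintegrable oE Hu1.
  have [Lv LDv] := H1_weak_gradient_sqintegrable oE Hv1.
  have c20 : 0 <= c ^+ 2 by exact: sqr_ge0.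
  (* Since (a - c b)^2 <= 2 a^2 + 2 c^2 b^2, an accuracy of eps / (2 + 2 c^2) for u and for v gives
     eps for the combination. *)
  have k0 : 0 < 2 + 2 * c ^+ 2 by lra.
  have lin (A B : R) : A < eps / (2 + 2 * c ^+ 2) -> B < eps / (2 + 2 * c ^+ 2) ->
      2 * A + 2 * c ^+ 2 * B < eps.
    move=> hA hB.
    have -> : eps = (2 + 2 * c ^+ 2) * (eps / (2 + 2 * c ^+ 2)).
      by rewrite mulrC divfK// gt_eqF.
    rewrite [ltRHS]mulrDl ltr_leD ?ltr_pM2l//.
    by apply: ler_wpM2l; [exact: mulr_ge0|exact: ltW].
  have [phi tp dphi] := H10_approximation oE Hu (divr_gt0 eps0 k0).
  have [psi tq dpsi] := H10_approximation oE Hv (divr_gt0 eps0 k0).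
  exists (fun x => phi x - c * psi x); first exact: test_functionB.
  have [Cp _ _] := tp; have [Cq _ _] := tq; have tr := test_functionB c tp tq.
  set du := fun x => _ in dphi; set dv := fun x => _ in dpsi.
  have Idu : integrable du.
    apply: (integrable_density oE (Du := fun i x => Du x 0 i - partial i phi x)) =>
        [|i].
      by apply: sqintegrableB => //; exact: sqintegrable_test_function.
    by apply: sqintegrableB => //; exact: sqintegrable_partial_test_function.
  have Idv : integrable dv.
    apply: (integrable_density oE (Du := fun i x => Dv x 0 i - partial i psi x)) =>
        [|i].
      by apply: sqintegrableB => //; exact: sqintegrable_test_function.
    by apply: sqintegrableB => //; exact: sqintegrable_partial_test_function.
  apply: (@le_lt_trans _ _ (2 * \int[mu]_(x in YF) du x +
      2 * c ^+ 2 * \int[mu]_(x in YF) dv x)).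
    rewrite -!RintegralZl// -RintegralD//; try exact: integrable_EFinZ.
    apply: le_Rintegral => //.
    - apply: (integrable_density oE (Du := fun i x =>
        (Du x - c *: Dv x) 0 i - partial i _ x)) => [|i].
        by apply: sqintegrableB => //; exact: sqintegrable_test_function.
      by apply: sqintegrableB => //; exact: sqintegrable_partial_test_function.
    - by apply: integrable_EFinD => //; exact: integrable_EFinZ.
    move=> x _; rewrite /du /dv.
    have sq (a b a' b' : R) : (a - c * b - (a' - c * b')) ^+ 2 <=
        2 * (a - a') ^+ 2 + 2 * c ^+ 2 * (b - b') ^+ 2.
      rewrite -subr_ge0 (_ : _ - _ = ((a - a') + c * (b - b')) ^+ 2) ?sqr_ge0//.
      by ring.
    rewrite (mulrDr 2) (mulrDr (2 * c ^+ 2)) addrACA; apply: lerD; first exact: sq.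
    rewrite !mulr_sumr -big_split /=; apply: ler_sum => i _.
    by rewrite partialB// !mxE; exact: sq.
  exact: lin dphi dpsi.
have /choice[chi chiP] : forall n : nat, exists chi, test_function E chi /\
    \int[mu]_(x in YF) ((u x - c * v x - chi x) ^+ 2 +
      \sum_(i < d) ((Du x - c *: Dv x) 0 i - partial i chi x) ^+ 2) < n.+1%:R^-1.
  move=> n; have n0 : 0 < n.+1%:R^-1 :> R by rewrite invr_gt0.
  by have [chi ? ?] := approx _ n0; exists chi.
exists chi; split=> [n|]; first by case: (chiP n).
have L n := sqintegrableB mYF Lw (sqintegrable_test_function oE (chiP n).1).
have LD n i : sqintegrable mu YF (fun x =>
    (\row_i ((Du x - c *: Dv x) 0 i - partial i (chi n) x)) 0 i).
  under eq_fun do rewrite mxE.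
  by apply: sqintegrableB => //; apply: sqintegrable_partial_test_function => //;
      case: (chiP n).
under eq_fun do rewrite H1_energyE//.
apply/fine_cvgP; split; first exact: nearW.
apply/cvgrPdist_lt => eps eps0; near=> n.
rewrite /= sub0r normrN ger0_norm; last first.
  apply: Rintegral_ge0 => x _; rewrite addr_ge0 ?sqr_ge0// sumr_ge0// => i _.
  exact: sqr_ge0.
apply: (@lt_trans _ _ n.+1%:R^-1); last first.
  by near: n; exact: (near_infty_natSinv_lt (PosNum eps0)).
apply: le_lt_trans (chiP n).2; rewrite le_eqVlt; apply/orP; left; apply/eqP.
apply: eq_Rintegral => x _; congr (_ + _); apply: eq_bigr => i _.
by rewrite mxE.
Unshelve. all: by end_near. Qed.

End H10_linear.

(** * The energy estimate *)

Section energy_estimate.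
Context (R : realType) (d : nat) (E : set 'rV[R]_d).
Local Notation mu := (lebesgue_rV d : {sigma_finite_measure set 'rV[R]_d -> \bar R}).
Local Notation YF := (fluid_cell E).
Local Notation integrable f := (mu.-integrable YF (EFin \o f)).

Lemma integrable_test_functionM F phi : open E -> test_function E phi -> integrable F ->
  integrable (fun x => F x * phi x).
Proof.
move=> oE tp IF; have mYF := measurable_fluid_cell oE.
have [M pM] := test_function_bounded tp.
have mF : measurable_fun YF F by apply/measurable_EFinP; exact: measurable_int IF.
apply: (@le_integrable_EFin _ _ _ _ _ mYF _ (fun x => M * `|F x|)).
- by apply: measurable_funM => //; apply: (measurable_test_function (E := E)).
- by move=> x _; rewrite normrM mulrC ler_wpM2r.
- by apply: integrable_EFinZ => //; exact: integrable_norm.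
Qed.

(** Test functions are bounded members of H^1_0, hence admissible; this is the form in which both
    equations enter the estimate. *)
Lemma weak_solution_test_function f (g : R) Psi : open E -> weak_solution E f g Psi ->
  exists DPsi : 'rV[R]_d -> 'rV[R]_d,
  [/\ H10_weak_gradient E (fun x => Psi x - g) DPsi, integrable (fun x => f (Psi x)) &
    forall phi, test_function E phi ->
    \int[mu]_(x in YF) (\sum_(i < d) DPsi x 0 i * partial i phi x +
        f (Psi x) * phi x) = 0].
Proof.
move=> oE [DPsi [_ H0 IF eqn]]; exists DPsi; split=> // phi tp.
have := eqn phi _ (H10_weak_gradient_test_function oE tp) (test_function_bounded tp).
rewrite /Rintegral => H; rewrite -[RHS]/(fine 0%E) -[in RHS]H; congr fine.
apply: eq_integral => x _; congr (_ + _)%:E; apply: eq_bigr => i _.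
by rewrite mxE.
Qed.

Lemma monotone_pairing (L b G u psi : R) : 0 <= L -> 0 <= b -> 0 <= G * u ->
  `|G| <= L * `|u| ->
  - (G * (u - b * psi)) <= L * b * `|psi| * `|u - b * psi|.
Proof.
move=> L0 b0 Gu GL; set w := u - b * psi.
have [h|h] := lerP 0 (G * w).
  by apply: (@le_trans _ _ 0); rewrite ?oppr_le0// !mulr_ge0.
(* If |u| exceeded b |psi|, then w would have the sign of u; as G u >= 0, this contradicts G w <
   0. *)
have up : `|u| <= b * `|psi|.
  rewrite leNgt; apply/negP => pu.
  have u0 : 0 < `|u| by apply: le_lt_trans pu; rewrite mulr_ge0.
  have wu : 0 < w * u.
    apply: (@lt_le_trans _ _ (`|u| * (`|u| - b * `|psi|))).
      by rewrite mulr_gt0// subr_gt0.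
    rewrite mulrBr -expr2 real_normK ?num_real// /w mulrBl -expr2 lerD2l lerN2.
    apply: (le_trans (ler_norm _)); rewrite !normrM (ger0_norm b0); lra.
  have u20 : 0 < u ^+ 2 by rewrite -(real_normK (num_real u)) exprn_gt0.
  have : 0 <= (G * u) * (w * u) by rewrite mulr_ge0// ltW.
  have -> : (G * u) * (w * u) = (G * w) * u ^+ 2 by ring.
  by rewrite leNgt nmulr_rlt0// ?u20.
apply: (le_trans (ler_norm _)); rewrite normrN normrM ler_wpM2r//.
by rewrite (le_trans GL)// -mulrA ler_wpM2l.
Qed.

Variables (N : nat) (z : 'I_N.+1 -> int) (n0 : 'I_N.+1 -> R).
Hypotheses (z_first : z ord0 < 0) (n0_gt0 : forall j, 0 < n0 j)
  (n0_neutral : \sum_(j < N.+1) (z j)%:~R * n0 j = 0).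

(** Beyond the threshold |zeta| the value Psi = zeta + u has the sign of u, and so has Phi(Psi). Its
    product with the barrier is then strictly positive, whereas the maximum principle makes this
    product vanish almost everywhere. *)
Lemma weak_solution_bounded (beta zeta : R) (Psi : 'rV[R]_d -> R) DPsi :
  open E -> 0 < beta -> H10_weak_gradient E (fun x => Psi x - zeta) DPsi ->
  integrable (fun x => beta * Phi z n0 (Psi x)) ->
  (forall phi, test_function E phi ->
    \int[mu]_(x in YF) (\sum_(i < d) DPsi x 0 i * partial i phi x +
      beta * Phi z n0 (Psi x) * phi x) = 0) ->
  {ae mu, forall x, YF x -> `|Psi x - zeta| <= `|zeta|}.
Proof.
move=> oE b0 H0 IF eqn.
have Phi_gt0 s : 0 < s -> 0 < Phi z n0 s.
  by move=> s0; rewrite -(Phi0 n0_neutral) Phi_strict_incr.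
have Phi_lt0 s : s < 0 -> Phi z n0 s < 0.
  by move=> s0; rewrite -(Phi0 n0_neutral) Phi_strict_incr.
have K0 := normr_ge0 zeta.
have pos x : ~~ (`|Psi x - zeta| <= `|zeta|) ->
    0 < beta * Phi z n0 (Psi x) * barrier `|zeta| (Psi x - zeta).
  rewrite -ltNge ltr_normr => /orP[ux|ux].
    have P0 : 0 < Psi x by have := lerNnormlW (lexx `|zeta|); lra.
    by rewrite mulr_gt0 ?mulr_gt0 ?Phi_gt0 ?barrier_gt0.
  have P0 : Psi x < 0 by have := ler_norm zeta; lra.
  rewrite nmulr_rgt0; first by rewrite barrier_lt0//; lra.
  by rewrite pmulr_rlt0// Phi_lt0.
have := weak_maximum_principle oE (is_derive_barrier `|zeta|) (@continuous_dbarrier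
    _ `|zeta|)
  _ (dbarrier_bound `|zeta|) (barrier_bound `|zeta|) (barrier_lipschitz `|zeta|) H0
      IF eqn _.
rewrite /ae_eq => /(_ _ _)/filterS; apply.
- move=> x Fx Yx; apply/negP => /negP /pos; have [->] := Fx Yx.
  by rewrite ltxx.
- by rewrite barrier_eq0// normr0.
- move=> x; case: (boolP (`|Psi x - zeta| <= `|zeta|)) => [ux|/pos/ltW//].
  by rewrite barrier_eq0// mulr0.
Qed.

Lemma energy_estimate (zeta : R) (Psi1 : 'rV[R]_d -> R) :
  fluid_domain E -> weak_solution E (fun=> Phi z n0 zeta) 0 Psi1 ->
  exists2 K : R, 0 <= K & forall (beta : R) Psi, 0 < beta ->
    weak_solution E (fun s => beta * Phi z n0 s) zeta Psi ->
    exists2 Dw, H1_weak_gradient E (fun x => Psi x - zeta - beta * Psi1 x) Dw &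
      (H1_energy E (fun x => Psi x - zeta - beta * Psi1 x)%R Dw <=
          (K * beta ^+ 4)%:E)%E.
Proof.
move=> Ef; have [oE _ _ _ _] := Ef; have mYF := measurable_fluid_cell oE.
have fYF := lebesgue_fluid_cell_lty oE.
move=> /(weak_solution_test_function oE)[DPsi1 [H1 IPhi1 eqn1]].
have {}H1 : H10_weak_gradient E Psi1 DPsi1 by move: H1; under eq_fun do rewrite subr0.
have [/(H1_weak_gradient_sqintegrable oE)[L1 LD1] _] := H1.
have [P P0 poincare] := poincare_H10 Ef.
(* From |u| <= |zeta| follows |Psi| <= 2 |zeta|. *)
have [L L0 lip] := Phi_lipschitz z n0 (2 * `|zeta|).
set p := \int[mu]_(x in YF) (Psi1 x ^+ 2).
have p0 : 0 <= p by apply: Rintegral_ge0 => x _; exact: sqr_ge0.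
(* The gradient part of the energy will be at most P L^2 p beta^4, and the Poincare inequality
   bounds the whole energy by P + 1 times that part. *)
exists ((P + 1) * (P * L ^+ 2 * p)).
  by rewrite !mulr_ge0 ?sqr_ge0// ?addr_ge0// ltW.
move=> beta Psi b0 /(weak_solution_test_function oE)[DPsi [H0 IF eqn]].
have bound := weak_solution_bounded oE b0 H0 IF eqn.
have Hw := H10_weak_gradientB oE beta H0 H1.
set w := fun x => Psi x - zeta - beta * Psi1 x in Hw *.
set Dw := fun x => DPsi x - beta *: DPsi1 x in Hw.
have [Hw1 _] := Hw.
exists Dw => //.
have [Lw LDw] := H1_weak_gradient_sqintegrable oE Hw1.
have [/(H1_weak_gradient_sqintegrable oE)[Lu LDu] _] := H0.
pose u x := Psi x - zeta.
pose B x := beta * Phi z n0 (Psi x) - beta * Phi z n0 zeta.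
(* B' is square integrable and differs from B on a null set only. *)
pose B' x := if `|u x| <= `|zeta| then B x else 0.
have Icst (c : R) : integrable (fun=> c).
  apply: (@integrable_bounded _ _ _ _ _ mYF fYF _ `|c|) => //.
have IB : integrable B by apply: integrable_EFinB.
have mB : measurable_fun YF B by apply/measurable_EFinP; exact: measurable_int IB.
have mB' : measurable_fun YF B'.
  apply: measurable_fun_if => //.
  - apply: measurable_fun_ler => //; apply: measurableT_comp => //; exact: Lu.1.
  - by apply: (measurable_funS mYF) => //.
have BE x : B x = beta * (Phi z n0 (Psi x) - Phi z n0 zeta) by rewrite /B mulrBr.
have B'bound x : `|B' x| <= beta * L * `|u x|.
  rewrite /B'; case: ifPn => ux; last by rewrite normr0 !mulr_ge0//; exact: ltW.
  rewrite BE normrM gtr0_norm// -mulrA ler_pM2l//.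
  apply: lip; last by have := normr_ge0 zeta; lra.
  have -> : Psi x = u x + zeta by rewrite subrK.
  by apply: (le_trans (ler_normD _ _)); lra.
have LB' : sqintegrable mu YF B'.
  split=> //; apply: (@le_integrable_EFin _ _ _ _ _ mYF _ (fun x =>
      (beta * L * u x) ^+ 2)).
  - exact: measurable_funX.
  - move=> x _; rewrite normrX -(real_normK (num_real (beta * L * u x))).
    rewrite lerXn2r ?nnegrE// normrM (ger0_norm (mulr_ge0 (ltW b0) (ltW L0))).
    exact: B'bound.
  - by case: (sqintegrableZ mYF (beta * L) Lu).
have eqnw phi : test_function E phi ->
    \int[mu]_(x in YF) (\sum_(i < d) Dw x 0 i * partial i phi x + B' x * phi x) = 0.
  move=> tp; have LDp i := sqintegrable_partial_test_function oE i tp.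
  have Iphi F : integrable F -> integrable (fun x => F x * phi x).
    exact: integrable_test_functionM.
  have I0 := integrable_pairing oE (A := fun i x => DPsi x 0 i) LDu LDp (Iphi _ IF).
  have I1 := integrable_pairing oE (A := fun i x => DPsi1 x 0 i) LD1 LDp (Iphi _ IPhi1).
  transitivity (\int[mu]_(x in YF) (\sum_(i < d) Dw x 0 i * partial i phi x +
      B x * phi x)).
    congr fine; apply: ae_eq_integral => //.
    - apply: measurable_int (integrable_pairing oE (A := fun i x =>
        Dw x 0 i) LDw LDp (Iphi _ _)).
      by apply: sqintegrable_integrable.
    - exact: measurable_int (integrable_pairing oE (A := fun i x =>
        Dw x 0 i) LDw LDp (Iphi _ IB)).
    apply: filterS bound => x ux Yx; congr (_ + _ * _)%:E.
    by rewrite /B' ifT//; exact: ux.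
  (* The equation for Psi minus beta times the one for [Psi1], whose source supplies the constant
     subtracted in [B]. *)
  transitivity (\int[mu]_(x in YF) (\sum_(i < d) DPsi x 0 i * partial i phi x +
      beta * Phi z n0 (Psi x) * phi x) -
     beta * \int[mu]_(x in YF) (\sum_(i < d) DPsi1 x 0 i * partial i phi x +
         Phi z n0 zeta * phi x)).
    rewrite -RintegralZl// -RintegralB//; last exact: integrable_EFinZ.
    apply: eq_Rintegral => x _; rewrite mulrDr opprD addrACA; congr (_ + _).
      rewrite mulr_sumr -sumrB; apply: eq_bigr => i _.
      by rewrite /Dw !mxE; ring.
    by rewrite /B; ring.
  by rewrite eqn// eqn1// mulr0 subr0.
(* As [B'] is square integrable, [w] itself may be used to test its equation. *)
have eqww := weak_equation_H10 oE (A := fun i x => Dw x 0 i) LDw LB' eqnw Hw.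
set a := \int[mu]_(x in YF) (w x ^+ 2).
set b := \int[mu]_(x in YF) (\sum_(i < d) Dw x 0 i ^+ 2).
have Iw : integrable (fun x => w x ^+ 2) by case: Lw.
have I1 : integrable (fun x => Psi1 x ^+ 2) by case: L1.
have IDw : integrable (fun x => \sum_(i < d) Dw x 0 i ^+ 2).
  by apply: integrable_EFin_sum => // i; case: (LDw i).
have ab : a <= P * b by exact: poincare Hw.
have IB'w := sqintegrableM mYF LB' Lw.
have bE : b = \int[mu]_(x in YF) (- (B' x * w x)).
  apply/eqP; rewrite -subr_eq0 -RintegralB//; last first.
    by have := integrable_EFinZ mYF (-1) IB'w; apply: eq_integrable => // x _ /=;
        rewrite mulN1r.
  apply/eqP; rewrite -[RHS]eqww; apply: eq_Rintegral => x _; rewrite opprK.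
  by congr (_ + _); apply: eq_bigr => i _; rewrite expr2.
(* The weight 1 / (2 P) is chosen so that the Poincare inequality bounds the first term by b / 2,
   which the left-hand side absorbs. *)
have bb : b <= (2 * P)^-1 * a + P / 2 * (L ^+ 2 * beta ^+ 4) * p.
  rewrite bE -!RintegralZl// -RintegralD//; try exact: integrable_EFinZ.
  apply: le_Rintegral => //.
  - by have := integrable_EFinZ mYF (-1) IB'w; apply: eq_integrable => // x _ /=;
      rewrite mulN1r.
  - by apply: integrable_EFinD => //; exact: integrable_EFinZ.
  move=> x _; apply: (@le_trans _ _ (L * beta ^+ 2 * `|Psi1 x| * `|w x|)).
    rewrite /B'; case: ifPn => ux; last by rewrite mul0r oppr0 !mulr_ge0//
        ?sqr_ge0 ?ltW.
    have Gu : 0 <= (Phi z n0 (Psi x) - Phi z n0 zeta) * u x.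
      have [h|h] := lerP (Psi x) zeta.
        by rewrite mulr_le0 ?subr_le0 ?Phi_incr.
      by rewrite mulr_ge0 ?subr_ge0 ?Phi_incr// ltW.
    have GL : `|Phi z n0 (Psi x) - Phi z n0 zeta| <= L * `|u x|.
      have := B'bound x; rewrite /B' ux BE normrM gtr0_norm// -mulrA.
      by rewrite ler_pM2l.
    (* One factor beta comes from |u| <= beta |Psi_1|, the other from B = beta G; together they give
       the power beta^2. *)
    have := monotone_pairing (Psi1 x) (ltW L0) (ltW b0) Gu GL.
    rewrite -/(w x) -(ler_pM2l b0); congr (_ <= _); last by ring.
    by rewrite BE; ring.
  rewrite -(real_normK (num_real (w x))) -(real_normK (num_real (Psi1 x))).
  rewrite -subr_ge0.
  have -> : (2 * P)^-1 * `|w x| ^+ 2 +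
      P / 2 * (L ^+ 2 * beta ^+ 4) * `|Psi1 x| ^+ 2 - L * beta ^+ 2 * `|Psi1 x| *
      `|w x| =
     (2 * P)^-1 * (`|w x| - P * L * beta ^+ 2 * `|Psi1 x|) ^+ 2.
    by field; rewrite gt_eqF.
  by rewrite mulr_ge0 ?sqr_ge0// invr_ge0 mulr_ge0// ltW.
have bfin : b <= P * L ^+ 2 * p * beta ^+ 4.
  have : (2 * P)^-1 * a <= b / 2.
    by rewrite invfM -mulrA mulrC ler_wpM2r// mulrC ler_pdivrMr// mulrC.
  lra.
rewrite (H1_energyE oE)// lee_fin RintegralD// -/a -/b.
apply: (@le_trans _ _ ((P + 1) * b)); first by rewrite mulrDl mul1r lerD2r.
by rewrite -mulrA ler_wpM2l// addr_ge0// ltW.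
Qed.

End energy_estimate.

(** * From the energy to the norm *)

Theorem lemma22 (R : realType) (d : nat) (E : set 'rV[R]_d)
    (d_gt0 : (0 < d)%N) (E_fluid : fluid_domain E)
    (N : nat) (z : 'I_N.+1 -> int) (n0 : 'I_N.+1 -> R)
    (z_incr : forall i j : 'I_N.+1, (i < j)%N -> z i < z j)
    (z_first : z ord0 < 0) (z_last : 0 < z ord_max)
    (n0_gt0 : forall j, 0 < n0 j)
    (n0_neutral : \sum_(j < N.+1) (z j)%:~R * n0 j = 0)
    (zeta : R) (Psi1 : 'rV[R]_d -> R)
    (Psi1_sol : weak_solution E (fun=> Phi z n0 zeta) 0 Psi1) :
  exists2 C : R, 0 < C &
    \forall beta \near 0^'+, forall Psi : 'rV[R]_d -> R,
      weak_solution E (fun s => beta * Phi z n0 s) zeta Psi ->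
      (H1_norm E (fun x => Psi x - zeta - beta * Psi1 x)%R
         <= (C * beta ^+ 2)%:E)%E.
Proof.
have [K K0 est] := energy_estimate z_first n0_gt0 n0_neutral E_fluid Psi1_sol.
(* The square root of K is at most 1 + K, which is positive even when K = 0. *)
exists (1 + K); first by rewrite ltr_pwDl.
near=> beta => Psi Psi_sol.
have b0 : 0 < beta by near: beta; exact: nbhs_right_gt.
have [Dw Hw le_energy] := est beta Psi b0 Psi_sol.
have b20 : 0 <= beta ^+ 2 by exact: sqr_ge0.
set w := (fun x => _)%R in Hw le_energy *.
have energy0 : (0 <= H1_energy E w Dw)%E.
  apply: integral_ge0 => x _; rewrite lee_fin addr_ge0 ?sqr_ge0// sumr_ge0// => i _.
  exact: sqr_ge0.
(* The norm is an infimum over weak gradients, so the one gradient [Dw] bounds it from above. *)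
apply: (@le_trans _ _ (H1_energy E w Dw `^ 2^-1)%E).
  by apply: ereal_inf_lbound; exists Dw.
apply: (@le_trans _ _ ((K * beta ^+ 4)%:E `^ 2^-1)%E).
  apply: gt0_ler_poweR => //; rewrite ?in_itv/= ?leey ?andbT//.
  by rewrite lee_fin mulr_ge0// exprn_ge0// ltW.
rewrite poweR_EFin lee_fin powR12_sqrt; last by rewrite mulr_ge0// exprn_ge0// ltW.
rewrite -[leRHS]ger0_norm; last by rewrite mulr_ge0// addr_ge0.
rewrite -sqrtr_sqr ler_sqrt; last by rewrite sqr_ge0.
rewrite exprMn -exprM; apply: ler_wpM2r; first by rewrite exprn_ge0// ltW.
by have := sqr_ge0 K; lra.
Unshelve. all: by end_near. Qed.
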